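(* Let $\mathbb{G}$ be a stratified group whose first stratum has dimension $N$ with $1<N<\infty$. Let $\Omega\subset\mathbb{G}$ be a bounded domain with $0\in\Omega$, and let $R=\sup_{x\in\Omega}|x'|$. Then for all complex-valued $f\in C_0^\infty(\Omega\setminus\{x'=0\})$, $$\left\|\frac{f(x)}{|x'|\log\frac{R}{|x'|}}\right\|_{L^N(\Omega)}\le\frac{N}{N-1}\left\|\frac{x'}{|x'|}\cdot\nabla_H f(x)\right\|_{L^N(\Omega)}.$$
   Context: A stratified group (homogeneous Carnot group) is a Lie group $\mathbb{G}=(\mathbb{R}^n,\circ)$ such that: (a) for some natural numbers $N=N_1,N_2,\dots,N_r$ with $N_1+\dots+N_r=n$, writing $\mathbb{R}^n=\mathbb{R}^{N}\times\mathbb{R}^{N_2}\times\dots\times\mathbb{R}^{N_r}$, for every $\lambda>0$ the dilation $\delta_\lambda(x',x^{(2)},\dots,x^{(r)})=(\lambda x',\lambda^2x^{(2)},\dots,\lambda^r x^{(r)})$ is an automorphism of $\mathbb{G}$, where $x'\in\mathbb{R}^N$ and $x^{(k)}\in\mathbb{R}^{N_k}$; (b) if $X_1,\dots,X_N$ are the left-invariant vector fields on $\mathbb{G}$ with $X_k(0)=\partial/\partial x'_k|_0$, then the iterated commutators of $X_1,\dots,X_N$ span the Lie algebra of $\mathbb{G}$ (rank $n$ at every point). $N$ is the dimension of the first stratum. Points are written $x=(x',x'')$ with $x'\in\mathbb{R}^N$ the first-stratum variables, and $|x'|$ is the Euclidean norm on $\mathbb{R}^N$. $\nabla_H=(X_1,\dots,X_N)$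 is the horizontal gradient and $x'\cdot\nabla_Hf=\sum_{k=1}^N x'_kX_kf$. $L^N(\Omega)$ is with respect to Lebesgue measure $dx$ on $\mathbb{R}^n$ (the Haar measure of $\mathbb{G}$). $C_0^\infty(U)$ denotes smooth functions with compact support in the open set $U$. *)

(* Defs.v *)
From HB Require Import structures.
From mathcomp Require Import all_boot all_order all_algebra.
From mathcomp Require Import all_classical all_reals all_analysis.
From mathcomp Require Import measurable_realfun complex.

Set Implicit Arguments.
Unset Strict Implicit.
Unset Printing Implicit Defensive.

Import Order.TTheory GRing.Theory Num.Theory.
Import numFieldNormedType.Exports.

Local Open Scope classical_set_scope.
Local Open Scope ring_scope.

(* 'rV[R]_n carries its Borel sigma-algebra. The n-dimensional Lebesgue
   measure is the n-fold product of lebesgue_measure, transported along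
   (t, x) |-> (t, x_0, ..., x_(n-1)) at each step. *)

Definition rV_display : measure_display.
Proof. exact: default_measure_display. Qed.

Section borel_rV.
Context {R : realType} {n : nat}.

Let borel0 : <<s @open 'rV[R]_n >> set0.
Proof. exact: sigma_algebra0. Qed.

Let borelC (A : set 'rV[R]_n) :
  <<s @open 'rV[R]_n >> A -> <<s @open 'rV[R]_n >> (~` A).
Proof. exact: sigma_algebraC. Qed.

Let borel_bigcup (F : (set 'rV[R]_n)^nat) :
  (forall i, <<s @open 'rV[R]_n >> (F i)) ->
  <<s @open 'rV[R]_n >> (\bigcup_i F i).
Proof. exact: sigma_algebra_bigcup. Qed.

HB.instance Definition _ := @isMeasurable.Build rV_display
  'rV[R]_n <<s @open 'rV[R]_n >> borel0 borelC borel_bigcup.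

End borel_rV.

Lemma open_measurable_rV (R : realType) (n : nat) (A : set 'rV[R]_n) :
  open A -> measurable A.
Proof. by move=> oA; exact: sub_sigma_algebra. Qed.

Lemma continuous_measurable_rV (R : realType) (n m : nat)
    (f : 'rV[R]_n -> 'rV[R]_m) : continuous f -> measurable_fun setT f.
Proof.
move=> /continuousP cf; apply: (measurability (@open 'rV[R]_m)) => //.
by move=> _ [A oA <-]; rewrite setTI; apply: open_measurable_rV; exact: cf.
Qed.

Lemma measurable_coord_rV (R : realType) (n : nat) (i : 'I_n) :
  measurable_fun setT (fun x : 'rV[R]_n => x ord0 i : measurableTypeR R).
Proof.
have /continuousP cf := @coord_continuous R 1 n ord0 i.
apply: (measurability _ (RGenOpens.measurableE R)) => _ [_ [a [b ->] <-]].
by rewrite setTI; apply: open_measurable_rV; exact/cf/interval_open.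
Qed.

Section lebesgue_rV.
Context {R : realType}.

Definition cons_rV (n : nat) (p : measurableTypeR R * 'rV[R]_n) :
  'rV[R]_(1 + n) := row_mx (p.1 : R)%:M p.2.

Lemma cons_rV0 n p : @cons_rV n p ord0 ord0 = p.1.
Proof.
rewrite /cons_rV; have -> : ord0 = lshift n (ord0 : 'I_1) by exact/val_inj.
by rewrite row_mxEl mxE.
Qed.

Lemma cons_rVS n p i : @cons_rV n p ord0 (rshift 1 i) = p.2 ord0 i.
Proof. by rewrite /cons_rV row_mxEr. Qed.

Lemma rV_rat_dense n (x : 'rV[R]_n) (e : R) : 0 < e ->
  exists q : 'rV[rat]_n, forall i, `|x ord0 i - ratr (q ord0 i)| < e.
Proof.
move=> e0; have H i : exists q : rat, `|x ord0 i - ratr q| < e.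
  have /rat_in_itvoo[q] : x ord0 i - e < x ord0 i + e by rewrite ltrD2l gtrN.
  by rewrite in_itv/= => qe; exists q; rewrite distrC ltr_distl.
by have [q qP] := choice H; exists (\row_i q i) => i; rewrite mxE.
Qed.

Let cube n (c : 'rV[rat]_n) (k : nat) : set 'rV[R]_n :=
  [set y | forall i, `|y ord0 i - ratr (c ord0 i)| < k.+1%:R^-1].

Let open_cube_cover n (U : set 'rV[R]_n) : open U ->
  U = \bigcup_(ck in [set ck : 'rV[rat]_n * nat | cube ck.1 ck.2 `<=` U])
        cube ck.1 ck.2.
Proof.
move=> oU; apply/seteqP; split; last by move=> x [ck ckU xck]; exact: ckU.
move=> x Ux; have /nbhs_ballP[e /= e0 eU] := open_nbhs_nbhs (conj oU Ux).
have [k ke] : exists k, k.+1%:R^-1 < e / 2 :> R.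
  have e20 : 0 < (e / 2)^-1 by rewrite invr_gt0 divr_gt0.
  exists (Num.truncn (e / 2)^-1).
  by rewrite -[ltRHS]invrK ltf_pV2 ?posrE// truncnS_gt.
have k0 : 0 < k.+1%:R^-1 :> R by rewrite invr_gt0.
have [c cx] := @rV_rat_dense n x _ k0.
exists (c, k) => //= y cy; apply: eU; split => // i j.
rewrite -ball_normE /= (ord1 i) -(subrKA (ratr (c ord0 j))).
rewrite (le_lt_trans (ler_normD _ _))// [X in _ < X]splitr ltrD//.
  exact: lt_trans (cx j) ke.
by rewrite distrC; exact: lt_trans (cy j) ke.
Qed.

Lemma measurable_cons_rV n : measurable_fun setT (@cons_rV n).
Proof.
apply: (measurability (@open 'rV[R]_(1 + n))) => // _ [U oU <-].
rewrite setTI (open_cube_cover oU) preimage_bigcup bigcup_mkcond.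
apply: countable_bigcupT_measurable; first exact: countableP.
move=> [c k]; case: ifPn => // _.
have -> : @cons_rV n @^-1` cube c k =
    [set t : measurableTypeR R | `|t - ratr (c ord0 ord0)| < k.+1%:R^-1] `*`
    cube (\row_i c ord0 (rshift 1 i)) k.
  apply/seteqP; split=> [[t y] /= cty|[t y] /= [ct cy] i].
    split=> [|i]; first by have := cty ord0; rewrite cons_rV0.
    by have := cty (rshift 1 i); rewrite cons_rVS mxE.
  case: (split_ordP i) => j ->.
    have -> : lshift n j = ord0 by rewrite (ord1 j); exact/val_inj.
    by rewrite cons_rV0.
  by rewrite cons_rVS; have := cy j; rewrite mxE.
apply: measurableX.
  set B := [set _ | _].
  have -> : B = ball (ratr (c ord0 ord0) : R) k.+1%:R^-1.
    by apply/seteqP; split=> t; rewrite -ball_normE /B/= distrC.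
  exact: measurable_ball.
rewrite (_ : cube _ _ = \bigcap_(i in [set: 'I_n]) [set y : 'rV[R]_n |
    `|y ord0 i - ratr ((\row_j c ord0 (rshift 1 j)) ord0 i)| < k.+1%:R^-1]).
  apply: fin_bigcap_measurable => // i _.
  set q := ratr _.
  have -> : [set y : 'rV[R]_n | `|y ord0 i - q| < k.+1%:R^-1] =
      (fun y : 'rV[R]_n => y ord0 i : measurableTypeR R) @^-1`
        ball (q : R) k.+1%:R^-1.
    by apply/seteqP; split=> t; rewrite -ball_normE /= distrC.
  rewrite -[X in measurable X]setTI.
  by apply: measurable_coord_rV => //; exact: measurable_ball.
by apply/seteqP; split=> [y Hy i _|y Hy i]; [exact: Hy|exact: (Hy i)].
Qed.

Section step.
Variables (n : nat) (mu : {sigma_finite_measure set 'rV[R]_n -> \bar R}).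

Definition lebesgue_rVS : set 'rV[R]_(1 + n) -> \bar R :=
  pushforward (@lebesgue_measure R \x mu)%E (@cons_rV n).

Let lebesgue_rVS0 : lebesgue_rVS set0 = 0%E.
Proof. by rewrite /lebesgue_rVS /pushforward preimage_set0 measure0. Qed.

Let lebesgue_rVS_ge0 A : (0 <= lebesgue_rVS A)%E.
Proof. by rewrite /lebesgue_rVS /pushforward; apply: measure_ge0. Qed.

Let lebesgue_rVS_sigma_additive : semi_sigma_additive lebesgue_rVS.
Proof.
have mc A : measurable A -> measurable (@cons_rV n @^-1` A).
  by move=> mA; rewrite -[X in measurable X]setTI; exact: measurable_cons_rV.
move=> F mF tF mUF; rewrite /lebesgue_rVS /pushforward preimage_bigcup.
apply: measure_semi_sigma_additive.
- by move=> k; exact: mc.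
- apply/trivIsetP => /= i j _ _ ij; rewrite -preimage_setI.
  by move/trivIsetP : tF => /(_ _ _ _ _ ij) ->//; rewrite preimage_set0.
- by rewrite -preimage_bigcup; exact: mc.
Qed.

HB.instance Definition _ := isMeasure.Build _ _ _ lebesgue_rVS
  lebesgue_rVS0 lebesgue_rVS_ge0 lebesgue_rVS_sigma_additive.

Let uncons (x : 'rV[R]_(1 + n)) : measurableTypeR R * 'rV[R]_n :=
  (x ord0 ord0, rsubmx x).

Let consK : cancel (@cons_rV n) uncons.
Proof.
by move=> [t y]; rewrite /uncons cons_rV0 /cons_rV row_mxKr.
Qed.

Let measurable_uncons : measurable_fun setT uncons.
Proof.
apply: measurable_fun_pair; first exact: measurable_coord_rV.
apply: continuous_measurable_rV => x A /nbhs_ballP[e e0 eA].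
apply/nbhs_ballP; exists e => // y [_ xy]; apply: eA; split => // i j.
by rewrite !mxE; exact: xy.
Qed.

Let lebesgue_rVS_sigma_finite : sigma_finite setT lebesgue_rVS.
Proof.
have /sigma_finiteP[F [FT ndF Foo]] := sigma_finiteT (@lebesgue_measure R).
have /sigma_finiteP[G [GT ndG Goo]] := sigma_finiteT mu.
exists (fun k => uncons @^-1` (F k `*` G k)).
  rewrite -preimage_bigcup -[LHS](preimage_setT uncons); congr (_ @^-1` _).
  rewrite -setXTT FT GT; apply/seteqP; split => [[t y] [/= [k _ Fk] [l _ Gl]]|].
    exists (maxn k l) => //; split.
      by move: t Fk; exact/subsetPset/ndF/leq_maxl.
    by move: y Gl; exact/subsetPset/ndG/leq_maxr.
  by move=> [t y] [k _ [/= Ft Gy]]; split; exists k.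
move=> k; have [mF Fk] := Foo k; have [mG Gk] := Goo k.
have mFG : measurable (F k `*` G k) by exact: measurableX.
split; first by rewrite -[X in measurable X]setTI; exact: measurable_uncons.
rewrite /lebesgue_rVS /pushforward -comp_preimage.
rewrite (_ : uncons \o _ = id); last by rewrite funeqE => p /=; rewrite consK.
rewrite preimage_id product_measure1E// lte_mul_pinfty//.
by rewrite ge0_fin_numE.
Qed.

HB.instance Definition _ := Measure_isSigmaFinite.Build _ _ _ lebesgue_rVS
  lebesgue_rVS_sigma_finite.

End step.

Fixpoint lebesgue_rV (n : nat) : {sigma_finite_measure set 'rV[R]_n -> \bar R} :=
  match n with
  | 0 => dirac (0 : 'rV[R]_0)
  | m.+1 => lebesgue_rVS (lebesgue_rV m)
  end.

End lebesgue_rV.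

Section box.
Context {R : realType}.

Definition box_rV (n : nat) (a b : 'rV[R]_n) : set 'rV[R]_n :=
  [set x | forall i, a ord0 i <= x ord0 i <= b ord0 i].

Lemma measurable_box_rV n (a b : 'rV[R]_n) : measurable (box_rV a b).
Proof.
rewrite (_ : box_rV a b = \bigcap_(i in [set: 'I_n])
    ((fun x : 'rV[R]_n => x ord0 i : measurableTypeR R) @^-1`
      [set` `[a ord0 i, b ord0 i]])).
  apply: fin_bigcap_measurable => // i _; rewrite -[X in measurable X]setTI.
  by apply: measurable_coord_rV.
apply/seteqP; split=> [x xab i _ /=|x xab i]; first by rewrite in_itv/=.
by have := xab i I; rewrite /= in_itv.
Qed.

Lemma lebesgue_rV_box n (a b : 'rV[R]_n) :
  (forall i, a ord0 i <= b ord0 i) ->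
  lebesgue_rV n (box_rV a b) = (\prod_i (b ord0 i - a ord0 i))%:E.
Proof.
elim: n a b => [|n ih] a b ab.
  by rewrite big_ord0 /= diracE mem_set// => -[].
pose tl (x : 'rV[R]_n.+1) : 'rV[R]_n := \row_i x ord0 (rshift 1 i).
have consbox : @cons_rV R n @^-1` box_rV a b =
    ([set` `[a ord0 ord0, b ord0 ord0]] : set (measurableTypeR R)) `*`
    box_rV (tl a) (tl b).
  apply/seteqP; split=> [[t y] /= H|[t y] /= [H1 H2] i].
    split=> [|i]; first by have := H ord0; rewrite cons_rV0 in_itv.
    by have := H (rshift 1 i); rewrite cons_rVS !mxE.
  case: (@split_ordP 1 n i) => j ->.
    have -> : lshift n j = ord0 by rewrite (ord1 j); exact/val_inj.
    by rewrite cons_rV0; move: H1; rewrite in_itv.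
  by rewrite cons_rVS; have := H2 j; rewrite !mxE.
have -> : lebesgue_rV n.+1 (box_rV a b) = (@lebesgue_measure R \x
  lebesgue_rV n)%E (@cons_rV R n @^-1` box_rV a b) by [].
rewrite consbox product_measure1E//; last exact: measurable_box_rV.
rewrite ih; last by move=> i; rewrite !mxE.
rewrite big_ord_recl EFinM; congr (_ * _)%E.
  have : lebesgue_measure [set` `[a ord0 ord0, b ord0 ord0]] =
      (b ord0 ord0 - a ord0 ord0)%:E.
    rewrite lebesgue_measure_itv/= lte_fin; case: ifPn; rewrite ?EFinB//.
    rewrite -leNgt => ba; have ab0 := ab ord0.
    by rewrite (le_anti (introT andP (conj ab0 ba))) subee.
  exact.
by congr EFin; apply: eq_bigr => i _; rewrite !mxE; congr (b _ _ - a _ _);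
  exact/val_inj.
Qed.

End box.

(* [is_Ck k f] says that f is of class C^k: f is k times differentiable and
   its partial derivatives of order k are continuous. *)
Fixpoint is_Ck {R : realType} {m : nat} {W : normedModType R} (k : nat)
    (f : 'rV[R]_m -> W) : Prop :=
  match k with
  | 0 => continuous f
  | l.+1 => (forall x, differentiable f x) /\
            (forall i : 'I_m, is_Ck l (fun x => 'D_(delta_mx 0 i) f x))
  end.

Definition smooth {R : realType} {m : nat} {W : normedModType R}
  (f : 'rV[R]_m -> W) : Prop := forall k, is_Ck k f.

Definition lie_bracket {R : realType} {n : nat} (X Y : 'rV[R]_n -> 'rV[R]_n) :
    'rV[R]_n -> 'rV[R]_n :=
  fun x => 'D_(X x) Y x - 'D_(Y x) X x.

Inductive iterated_commutator {R : realType} {n : nat} {I : Type}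
    (X : I -> 'rV[R]_n -> 'rV[R]_n) : ('rV[R]_n -> 'rV[R]_n) -> Prop :=
| commutator_gen i : iterated_commutator X (X i)
| commutator_bracket Y Z : iterated_commutator X Y ->
    iterated_commutator X Z -> iterated_commutator X (lie_bracket Y Z).

(* The strata have dimensions N, N_2, ..., N_r with Ns = [:: N_2; ...; N_r],
   so the group is R^n with n = N + sumn Ns. The coordinates are split into
   consecutive blocks of these sizes, and reshape_index finds the block of a
   coordinate, counted from 0. *)
Definition dilation {R : realType} {N : nat} {Ns : seq nat} (lambda : R)
    (x : 'rV[R]_(N + sumn Ns)) : 'rV[R]_(N + sumn Ns) :=
  \row_i (lambda ^+ (reshape_index (N :: Ns) i).+1 * x ord0 i).

(* The vector fields X_1, ..., X_N are sg_field, which sg_left_invariant and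
   sg_field0 determine uniquely. The neutral element is fixed by every
   dilation, hence it is 0. *)
Record stratified_group (R : realType) (N : nat) (Ns : seq nat) := {
  sg_mul : 'rV[R]_(N + sumn Ns) -> 'rV[R]_(N + sumn Ns) ->
           'rV[R]_(N + sumn Ns);
  sg_one : 'rV[R]_(N + sumn Ns);
  sg_inv : 'rV[R]_(N + sumn Ns) -> 'rV[R]_(N + sumn Ns);
  sg_field : 'I_N -> 'rV[R]_(N + sumn Ns) -> 'rV[R]_(N + sumn Ns);
  sg_strata : 0%N \notin N :: Ns;
  sg_mulA : associative sg_mul;
  sg_mul1 : left_id sg_one sg_mul;
  sg_mulr1 : right_id sg_one sg_mul;
  sg_mulV : left_inverse sg_one sg_inv sg_mul;
  sg_mulrV : right_inverse sg_one sg_inv sg_mul;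
  sg_mul_smooth : smooth (fun z : 'rV[R]_((N + sumn Ns) + (N + sumn Ns)) =>
    sg_mul (lsubmx z) (rsubmx z));
  sg_inv_smooth : smooth sg_inv;
  sg_dilation : forall lambda : R, 0 < lambda ->
    {morph @dilation R N Ns lambda : x y / sg_mul x y};
  sg_left_invariant : forall k x y,
    'd (sg_mul x) y (sg_field k y) = sg_field k (sg_mul x y);
  sg_field0 : forall k, sg_field k 0 = delta_mx 0 (lshift (sumn Ns) k);
  sg_rank : forall x, exists Z : 'I_(N + sumn Ns) ->
      'rV[R]_(N + sumn Ns) -> 'rV[R]_(N + sumn Ns),
    (forall j, iterated_commutator sg_field (Z j)) /\
    \rank (\matrix_j Z j x) = (N + sumn Ns)%N
}.

Definition stratum1 {R : realType} {N m : nat} (x : 'rV[R]_(N + m)) : 'rV[R]_N :=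
  lsubmx x.

Definition enorm {R : realType} {N : nat} (v : 'rV[R]_N) : R :=
  Num.sqrt (\sum_i v ord0 i ^+ 2).

(* Functions on U are identified with their extensions by 0 to R^n. *)
Definition Cc_infty {R : realType} {n : nat} (U : set 'rV[R]_n)
    (f : 'rV[R]_n -> R[i]) : Prop :=
  [/\ smooth (fun x => complex.Re (f x)),
      smooth (fun x => complex.Im (f x)),
      compact (closure [set x | f x != 0]) &
      closure [set x | f x != 0] `<=` U].

Definition vderive {R : realType} {n : nat} (X : 'rV[R]_n -> 'rV[R]_n)
    (f : 'rV[R]_n -> R[i]) (x : 'rV[R]_n) : R[i] :=
  Complex ('D_(X x) (fun y => complex.Re (f y)) x)
          ('D_(X x) (fun y => complex.Im (f y)) x).

Definition hgradient {R : realType} {N : nat} {Ns : seq nat}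
    (G : stratified_group R N Ns) (f : 'rV[R]_(N + sumn Ns) -> R[i])
    (x : 'rV[R]_(N + sumn Ns)) : 'rV[R[i]]_N :=
  \row_k vderive (sg_field G k) f x.

Definition dotc {R : realType} {N : nat} (v : 'rV[R]_N) (w : 'rV[R[i]]_N) : R[i] :=
  \sum_k (v ord0 k)%:C%C * w ord0 k.

(* The restriction \_ takes the value 0 outside Omega. *)
Definition Lp_norm {R : realType} {n : nat} (Omega : set 'rV[R]_n) (p : R)
    (g : 'rV[R]_n -> R[i]) : \bar R :=
  ('N[lebesgue_rV n]_(p%:E)
     [(fun x => (ComplexField.Normc.normc (g x))%:E) \_ Omega])%E.

(* Main.v *)
Require Import Defs.
From HB Require Import structures.
From mathcomp Require Import all_boot all_order all_algebra.
From mathcomp Require Import all_classical all_reals all_analysis.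
From mathcomp Require Import measurable_realfun complex.
From mathcomp Require Import ring lra.

(** Write s = |x'| and L = ln (R / s). On a stratified group the horizontal
    field Y = sum_k x'_k X_k plays the part of the Euler field of the first
    stratum: Y s = s, and the divergence of Y is N. Both facts come from
    homogeneity under the dilations. Differentiating the automorphism property shows that the i-th
    coefficient of X_k is homogeneous of degree weight i - 1, so its derivative
    along x_j is homogeneous of negative degree as soon as
    weight j >= weight i; a homogeneous function of negative degree that is
    continuous at the origin vanishes (sg_field_partial_eq0). In the same way
    the first-stratum coefficients are constant (sg_field_stratum1).

    The weight w(s) = s^-N L^(1-N) / (N - 1) satisfies s w' + N w = (s L)^-N.
    Hence the divergence of |f|^N w(s) Y is

      (|f| / (s L))^N + w(s) Y(|f|^N),

    and its integral is 0, because f has compact support in a region where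
    0 < s < R and the integral of each partial derivative vanishes by
    Fubini and the fundamental theorem of calculus (integral_partial_eq0).

    Put A = |f| / (s L) and b = N / (N - 1) |Y f| / s. Since
    |Y(|f|^N)| <= N |f|^(N-1) |Y f|, the divergence is at least
    A^N - A^(N-1) b, and the arithmetic-geometric mean inequality
    N A^(N-1) b <= (N - 1) A^N + b^N bounds this below by (A^N - b^N) / N
    (hardy_pointwise). Integrating gives that the integral of A^N is at most
    that of b^N (hardy_integral_power); taking N-th roots is the theorem, as
    Y f / s is the radial component of the horizontal gradient. *)

Set Implicit Arguments.
Unset Strict Implicit.
Unset Printing Implicit Defensive.

Import Order.TTheory GRing.Theory Num.Theory.
Import numFieldNormedType.Exports.

Local Open Scope classical_set_scope.
Local Open Scope ring_scope.

(** * Derivatives along affine maps *)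

Section derive_affine.
Context {R : numFieldType} {U V W : normedModType R}.

(** An affine map carries difference quotients to difference quotients
    verbatim, so directional derivatives are transported along slices, sections
    x |-> (x, 0) and dilations. *)
Lemma growth_rate_affine (f : V -> W) (phi : U -> V) (x v : U) (w : V) :
  (forall h : R, phi (h *: v + x) = h *: w + phi x) ->
  (fun h : R => h^-1 *: (((f \o phi) \o shift x) (h *: v) - (f \o phi) x)) =
  (fun h => h^-1 *: ((f \o shift (phi x)) (h *: w) - f (phi x))).
Proof. by move=> phiE; apply/funext => h /=; rewrite phiE. Qed.

Lemma derive_affine (f : V -> W) (phi : U -> V) (x v : U) (w : V) :
  (forall h : R, phi (h *: v + x) = h *: w + phi x) ->
  'D_v (f \o phi) x = 'D_w f (phi x).
Proof. by move=> phiE; rewrite /derive (growth_rate_affine f phiE). Qed.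

Lemma derivable_affine (f : V -> W) (phi : U -> V) (x v : U) (w : V) :
  (forall h : R, phi (h *: v + x) = h *: w + phi x) ->
  derivable (f \o phi) x v = derivable f (phi x) w.
Proof. by move=> phiE; rewrite /derivable (growth_rate_affine f phiE). Qed.

Lemma is_derive_affine (f : V -> W) (phi : U -> V) (x v : U) (w : V) (df : W) :
  (forall h : R, phi (h *: v + x) = h *: w + phi x) ->
  is_derive x v (f \o phi) df <-> is_derive (phi x) w f df.
Proof.
move=> phiE; split=> -[dv dE]; apply: DeriveDef.
- by rewrite -(derivable_affine f phiE).
- by rewrite -(derive_affine f phiE).
- by rewrite (derivable_affine f phiE).
- by rewrite (derive_affine f phiE).
Qed.

End derive_affine.

(** * Integrals of partial derivatives *)

Section measure_rV.
Context {R : realType}.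

Lemma near_gt_coord n (M : R) (x : 'rV[R]_n) i : M < `|x ord0 i| ->
  \near x, M < `|(x : 'rV[R]_n) ord0 i|.
Proof.
move=> Mx.
have c : {for x, continuous (fun y : 'rV[R]_n => `|y ord0 i|)}.
  apply: (@continuous_comp _ _ _ (fun y : 'rV[R]_n => y ord0 i) Num.norm).
    exact: coord_continuous.
  exact: norm_continuous.
exact: (cvgr_gt _ c _ Mx).
Qed.

Lemma measurable_continuous_rV n (g : 'rV[R]_n -> R) :
  continuous g -> measurable_fun setT (g : _ -> measurableTypeR R).
Proof.
move=> /continuousP cf.
apply: (measurability _ (RGenOpens.measurableE R)) => _ [_ [a [b ->] <-]].
by rewrite setTI; apply: open_measurable_rV; exact/cf/interval_open.
Qed.

Lemma continuous_cpt_integrable n (g : 'rV[R]_n -> R) (M : R) :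
  continuous g -> (forall (x : 'rV[R]_n) i, M < `|x ord0 i| -> g x = 0) ->
  (lebesgue_rV n).-integrable setT (EFin \o g).
Proof.
move=> cg g0.
pose a : 'rV[R]_n := \row_i (- `|M|); pose b : 'rV[R]_n := \row_i `|M|.
have ab i : a ord0 i <= b ord0 i by rewrite !mxE ge0_cp.
have -> : EFin \o g = (EFin \o g) \_ (box_rV a b).
  apply/funext => x; rewrite /patch; case: ifPn => //= /negP xab.
  congr EFin; apply: contrapT => /eqP gx; apply: xab; rewrite inE => i.
  rewrite !mxE -ler_norml leNgt; apply/negP => Mx.
  by move/eqP: gx; apply; apply: (g0 x i); rewrite (le_lt_trans (ler_norm _)).
rewrite -integrable_mkcond; last exact: measurable_box_rV.
apply: measurable_bounded_integrable.
- exact: measurable_box_rV.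
- by rewrite [X in (X < _)%E](lebesgue_rV_box ab) ltry.
- by apply: measurable_funTS; exact: measurable_continuous_rV.
have cpt : compact (box_rV a b).
  exact: (@rV_compact R n (fun i => [set` `[a ord0 i, b ord0 i]])
    (fun i => @segment_compact _ _ _)).
have /compact_bounded[m [_ mrt]] : compact (g @` box_rV a b).
  by apply: continuous_compact cpt; exact: continuous_subspaceT.
by exists m; split; rewrite ?num_real // => ? ? ? ?; exact: mrt.
Qed.

Lemma cons_rV_shift0 n (t h : R) (y : 'rV[R]_n) :
  h *: delta_mx 0 ord0 + cons_rV (t, y) = cons_rV (h + t, y) :> 'rV[R]_(1 + n).
Proof.
apply/rowP => i; rewrite /cons_rV !mxE /=; case: splitP => j ij; rewrite ?mxE.
  by rewrite (ord1 j) /= (_ : i == ord0) ?mulr1// -val_eqE /= ij (ord1 j).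
by rewrite (_ : i == ord0 = false) ?mulr0 ?add0r// -val_eqE /= ij.
Qed.

Lemma cons_rV_shiftS n (t h : R) (y : 'rV[R]_n) j :
  h *: delta_mx 0 (rshift 1 j) + cons_rV (t, y) =
  cons_rV (t, h *: delta_mx 0 j + y) :> 'rV[R]_(1 + n).
Proof.
apply/rowP => i; rewrite /cons_rV !mxE /=; case: splitP => k ik; rewrite ?mxE.
  rewrite (_ : i == rshift 1 j = false) ?mulr0 ?add0r// -val_eqE /= ik (ord1 k).
  by [].
by rewrite -val_eqE /= ik eqn_add2l.
Qed.

Lemma continuous_cons_rVl n (y : 'rV[R]_n) :
  continuous (fun t : R => cons_rV (t, y) : 'rV[R]_(1 + n)).
Proof.
move=> t A /nbhs_ballP[e e0 eA]; apply/nbhs_ballP; exists e => // s st.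
apply: eA; split => // i j; rewrite !mxE; case: splitP => k _ /=.
  by rewrite !mxE (ord1 k) (ord1 i) /= !mulr1n.
by rewrite (ord1 i); exact: ballxx.
Qed.

Lemma continuous_cons_rVr n (t : R) :
  continuous (fun y : 'rV[R]_n => cons_rV (t, y) : 'rV[R]_(1 + n)).
Proof.
move=> y A /nbhs_ballP[e e0 eA]; apply/nbhs_ballP; exists e => // s [_ st].
apply: eA; split => // i j; rewrite !mxE; case: splitP => k _ /=.
  by rewrite (ord1 i); exact: ballxx.
by rewrite (ord1 i); exact: st.
Qed.

(** The measure of dimension 1 + n is the image of a product, so integration
    over it is integration over the product; with the integrability below this
    opens the way to Fubini in either order. *)
Lemma integral_lebesgue_rVS n (g : 'rV[R]_(1 + n) -> R) (M : R) :
  continuous g -> (forall (x : 'rV[R]_(1 + n)) i, M < `|x ord0 i| -> g x = 0) ->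
  (\int[lebesgue_rV (1 + n)]_x (g x)%:E =
   \int[@lebesgue_measure R \x lebesgue_rV n]_z (g (cons_rV z))%:E)%E /\
  (@lebesgue_measure R \x lebesgue_rV n)%E.-integrable setT
    (fun z => (g (cons_rV z))%:E).
Proof.
move=> cg g0.
have mg : measurable_fun setT (EFin \o g).
  by apply/measurable_EFinP; exact: measurable_continuous_rV.
have ig := continuous_cpt_integrable cg g0.
have mc := @measurable_cons_rV R n.
have ic : (@lebesgue_measure R \x lebesgue_rV n)%E.-integrable setT
    ((EFin \o g) \o @cons_rV R n).
  apply/integrableP; split; first exact: measurableT_comp.
  move/integrableP : ig => [_]; apply: le_lt_trans.
  have := @ge0_integral_pushforward _ _ _ _ R _ mc
    (@lebesgue_measure R \x lebesgue_rV n)%E setT (fun x => `|(g x)%:E|%E)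
    measurableT.
  rewrite preimage_setT => <- //.
  by apply: measurable_funTS; apply: measurableT_comp.
split=> //.
have := @integral_pushforward _ _ _ _ R _ mc
    (@lebesgue_measure R \x lebesgue_rV n)%E setT (EFin \o g) mg.
by rewrite preimage_setT => /(_ ic measurableT).
Qed.

Lemma integral_derive1_eq0 (g : R -> R) (M : R) :
  (forall t, derivable g t 1) -> continuous (fun t => 'D_1 g t) ->
  (forall t, M < `|t| -> g t = 0) ->
  (\int[@lebesgue_measure R]_t ('D_1 g t)%:E = 0)%E.
Proof.
move=> dg cg g0.
(* The margin 1 makes g vanish at the end points, not just outside them. *)
pose a := - (`|M| + 1); pose b := `|M| + 1.
have Mb : M < `|M| + 1 by rewrite (le_lt_trans (ler_norm _))// ltrDl.
have b0 : 0 < b by rewrite /b ltr_wpDl.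
have ab : a < b by rewrite /a -/b; lra.
have gb : g b = 0 by apply: g0; rewrite gtr0_norm.
have ga : g a = 0 by apply: g0; rewrite normrN gtr0_norm.
have cgg t : {for t, continuous g}.
  by apply: differentiable_continuous; apply/derivable1_diffP.
have dg0 t : M < `|t| -> 'D_1 g t = 0.
  move=> Mt; rewrite -(derive_cst (0:R) t 1); apply: near_eq_derive.
  near=> s; apply: g0; near: s.
  by apply: (cvgr_gt _ _ _ Mt); apply: cvg_norm.
have := @continuous_FTC2 R (fun t => 'D_1 g t) g a b ab.
rewrite ga gb subee// => <-; last 3 first.
- exact: continuous_subspaceT.
- by split => //; [exact/cvg_at_right_filter/cgg|exact/cvg_at_left_filter/cgg].
- by move=> x _; rewrite derive1E.
rewrite [RHS]integral_mkcond; apply: eq_integral => t _; rewrite patchE.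
case: ifPn => // /negP tab; congr EFin; apply: dg0.
rewrite ltNge; apply/negP => tM; apply: tab.
by rewrite inE /= in_itv /= -ler_norml (le_trans tM)// ltW.
Unshelve. all: by end_near. Qed.

(** By Fubini the integral along the i-th coordinate may be taken first, where
    the fundamental theorem of calculus gives 0. In the induction on n the
    coordinate 0 is split off: it is integrated first when i = 0, last when i is
    a coordinate of the remaining factor. *)
Lemma integral_partial_eq0 n (i : 'I_n) (g : 'rV[R]_n -> R) (M : R) :
  (forall x, derivable g x (delta_mx 0 i)) ->
  continuous (fun x => 'D_(delta_mx 0 i) g x) ->
  (forall (x : 'rV[R]_n) j, M < `|x ord0 j| -> g x = 0) ->
  (\int[lebesgue_rV n]_x ('D_(delta_mx 0 i) g x)%:E = 0)%E.
Proof.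
elim: n i g => [[]//|n ih] i g dg cg g0.
have dg0 (x : 'rV[R]_n.+1) j : M < `|x ord0 j| -> 'D_(delta_mx 0 i) g x = 0.
  move=> Mx; rewrite -(derive_cst (0:R) x (delta_mx 0 i)).
  apply: near_eq_derive.
  by apply: filterS (near_gt_coord Mx) => y; exact: g0.
have [-> int] := integral_lebesgue_rVS (n := n) cg dg0.
have coordS (t : R) (y : 'rV[R]_n) j : M < `|y ord0 j| ->
    M < `|cons_rV (t, y) ord0 (rshift 1 j)|.
  by rewrite cons_rVS.
have coord0 (t : R) (y : 'rV[R]_n) : M < `|t| ->
    M < `|cons_rV (t, y) ord0 ord0|.
  by rewrite cons_rV0.
case: (@split_ordP 1 n i) => j ij.
  have {}ij : i = ord0 by apply/val_inj; rewrite ij /= (ord1 j).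
  subst i.
  rewrite -integral21_prod_meas1//; apply: integral0_eq => y _ /=.
  pose line (t : R) : 'rV[R]_(1 + n) := cons_rV (t, y).
  pose gy := g \o line.
  have lineE t (h : R) :
      line (h *: (1 : R) + t) = h *: delta_mx 0 ord0 + line t.
    by rewrite /line cons_rV_shift0 /GRing.scale /= mulr1.
  rewrite -[RHS](_ : (\int[@lebesgue_measure R]_t ('D_1 gy t)%:E = 0)%E).
    by apply: eq_integral => t _; rewrite -(derive_affine g (lineE t)).
  apply: (@integral_derive1_eq0 _ M).
  - by move=> t; rewrite (derivable_affine g (lineE t)); exact: dg.
  - have -> : (fun t => 'D_1 gy t) =
        (fun x => 'D_(delta_mx 0 ord0) g x) \o line.
      by apply/funext => t /=; rewrite -(derive_affine g (lineE t)).
    by move=> t; apply: continuous_comp; [exact: continuous_cons_rVl|exact: cg].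
  - by move=> t Mt; apply: (g0 _ ord0); exact: coord0.
subst i.
rewrite -integral12_prod_meas1//; apply: integral0_eq => t _ /=.
pose slice (y : 'rV[R]_n) : 'rV[R]_(1 + n) := cons_rV (t, y).
pose gt := g \o slice.
have sliceE y (h : R) :
    slice (h *: delta_mx 0 j + y) = h *: delta_mx 0 (rshift 1 j) + slice y.
  by rewrite /slice cons_rV_shiftS.
rewrite -[RHS](ih j gt).
- by apply: eq_integral => y _; rewrite -(derive_affine g (sliceE y)).
- by move=> y; rewrite (derivable_affine g (sliceE y)); exact: dg.
- have -> : (fun y => 'D_(delta_mx 0 j) gt y) =
      (fun x => 'D_(delta_mx 0 (rshift 1 j)) g x) \o slice.
    by apply/funext => y /=; rewrite -(derive_affine g (sliceE y)).
  by move=> y; apply: continuous_comp; [exact: continuous_cons_rVr|exact: cg].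
- by move=> y k My; apply: (g0 _ (rshift 1 k)); exact: coordS.
Qed.

End measure_rV.

(** * The horizontal fields and the dilations *)

Section directional_scale.
Context {R : realType} {V : normedModType R}.

(** Reduces directional calculus to functions of one real variable, for which
    a chain rule is available. *)
Lemma is_derive_line (f : V -> R) (x v : V) (df : R) :
  is_derive (0 : R) 1 (fun h : R => f (h *: v + x)) df <-> is_derive x v f df.
Proof.
have := @is_derive_affine R R V R f (fun h : R => h *: v + x) 0 1 v df.
rewrite scale0r add0r; apply => h.
by rewrite addr0 [h *: 1]mulr1.
Qed.

Lemma is_derive_scale (f : V -> R) (x v : V) (c df : R) :
  is_derive x v f df -> is_derive x (c *: v) f (c * df).
Proof.
move=> /is_derive_line fx; apply/is_derive_line.
rewrite mulrC.
have -> : (fun h : R => f (h *: (c *: v) + x)) =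
    (fun h : R => f (h *: v + x)) \o (fun h => h * c).
  by apply/funext => h /=; rewrite scalerA.
apply: is_derive1_comp; first by rewrite mul0r.
apply: is_derive_eq.
by rewrite scaler0 add0r [_%:A]mulr1.
Qed.

End directional_scale.

Section at_right_value.
Context {R : realType}.

(** How homogeneity is exploited: a function of the dilation parameter that is
    constant for positive parameters keeps its value at 0. *)
Lemma continuous_pos_cst (g : R -> R) (c : R) : {for 0, continuous g} ->
  (forall l, 0 < l -> g l = c) -> g 0 = c.
Proof.
move=> g0 gc; have h1 : g l @[l --> 0^'+] --> g 0 by exact/cvg_at_right_filter.
have h2 : g l @[l --> 0^'+] --> c.
  by apply: cvg_near_cst; near=> l; apply: gc; near: l; exact: nbhs_right_gt.
exact: (cvg_unique _ h1 h2).
Unshelve. all: by end_near. Qed.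

End at_right_value.

Section continuous_rV.
Context {R : realType}.

Lemma continuous_rowP (T : topologicalType) n (g : T -> 'rV[R]_n) :
  (forall i, continuous (fun t => g t ord0 i)) -> continuous g.
Proof.
move=> cg t; apply/cvg_ballP => e e0.
near=> s; split=> // i j; rewrite (ord1 i).
move: j; near: s; apply: filter_forall => j.
by have /cvg_ballP := cg j t; apply.
Unshelve. all: by end_near. Qed.

End continuous_rV.

Section stratified.
Context {R : realType} {N : nat} {Ns : seq nat} (G : stratified_group R N Ns).
Local Notation n := (N + sumn Ns)%N.
Local Notation X := (sg_field G).
Local Notation mul := (sg_mul G).

(** The exponent with which dilations act on the i-th coordinate; blocks are
    counted from 0, whence the successor. *)
Definition weight (i : 'I_n) : nat := (reshape_index (N :: Ns) i).+1.

Lemma weight_lshift (k : 'I_N) : weight (lshift (sumn Ns) k) = 1%N.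
Proof. by rewrite /weight /reshape_index /= subn_eq0 ltn_ord. Qed.

Lemma dilationE (l : R) (x : 'rV[R]_n) i :
  dilation l x ord0 i = l ^+ weight i * x ord0 i.
Proof. by rewrite mxE. Qed.

Lemma dilation0 (x : 'rV[R]_n) : dilation 0 x = 0.
Proof. by apply/rowP => i; rewrite dilationE mxE expr0n mul0r. Qed.

Lemma dilationr0 (l : R) : dilation l 0 = 0 :> 'rV[R]_n.
Proof. by apply/rowP => i; rewrite dilationE !mxE mulr0. Qed.

Lemma continuous_dilation (x : 'rV[R]_n) :
  continuous (fun l : R => dilation l x).
Proof.
apply: continuous_rowP => i.
rewrite [X in continuous X](_ : _ =
  fun l => l ^+ weight i * x ord0 i); last first.
  by apply/funext => l; rewrite dilationE.
move=> l; apply: cvgM; last exact: cvg_cst.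
exact: exprn_continuous.
Qed.

Lemma dilation_shift (l h : R) (x : 'rV[R]_n) j :
  dilation l (h *: delta_mx 0 j + x) =
  h *: (l ^+ weight j *: delta_mx 0 j) + dilation l x.
Proof.
apply/rowP => i; rewrite !(dilationE, mxE) -/(weight i) eqxx /=.
have [->|_] := eqVneq i j; first by rewrite !mulr1; ring.
by rewrite !mulr0 !add0r.
Qed.

(** Dilations are surjective automorphisms, so they fix the neutral element,
    while the dilation by 2 fixes only the origin. *)
Lemma sg_one0 : sg_one G = 0.
Proof.
have two0 : 0 < 2 :> R by [].
have dK (y : 'rV[R]_n) : dilation 2 (dilation 2^-1 y) = y.
  apply/rowP => i; rewrite !dilationE mulrA -exprMn divff ?expr1n ?mul1r//.
have d1 : dilation 2 (sg_one G) = sg_one G.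
  rewrite -[LHS](sg_mulr1 G) -[X in mul _ X](dK (sg_one G)).
  by rewrite -(sg_dilation G two0) sg_mul1 dK.
apply/rowP => i; have := congr1 (fun M : 'rV[R]_n => M ord0 i) d1.
rewrite dilationE mxE => /eqP; rewrite -subr_eq0 -[X in _ - X]mul1r -mulrBl.
rewrite mulf_eq0 => /orP[|/eqP//].
by rewrite subr_eq0 gt_eqF// exprn_egt1// ltr1n.
Qed.

Lemma sg_mulx0 x : mul x 0 = x.
Proof. by rewrite -sg_one0 sg_mulr1. Qed.

(* The group law on a single space, the form in which it is smooth. *)
Let mulZ (z : 'rV[R]_(n + n)) := mul (lsubmx z) (rsubmx z).

Let mulZE x y : mul x y = mulZ (row_mx x y).
Proof. by rewrite /mulZ row_mxKl row_mxKr. Qed.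

Let differentiable_mulZ z : differentiable mulZ z.
Proof. by have [] := sg_mul_smooth G 1. Qed.

Let row_mx_shiftl m1 m2 (h : R) (x v : 'rV[R]_m1) (y : 'rV[R]_m2) :
  row_mx (h *: v + x) y = h *: row_mx v 0 + row_mx x y.
Proof. by rewrite scale_row_mx add_row_mx scaler0 add0r. Qed.

Let row_mx_shiftr m1 m2 (h : R) (x : 'rV[R]_m1) (y v : 'rV[R]_m2) :
  row_mx x (h *: v + y) = h *: row_mx 0 v + row_mx x y.
Proof. by rewrite scale_row_mx add_row_mx scaler0 add0r. Qed.

Let row_delta_r (k : 'I_n) :
  row_mx 0 (delta_mx 0 k) = delta_mx 0 (rshift n k) :> 'rV[R]_(n + n).
Proof.
apply/rowP => i; rewrite !mxE; case: splitP => j ij;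
  rewrite !mxE -!val_eqE /= ij.
  by rewrite ltn_eqF// (leq_trans (ltn_ord j)) ?leq_addr.
by rewrite eqn_add2l.
Qed.

Let row_delta_l (k : 'I_n) :
  row_mx (delta_mx 0 k) 0 = delta_mx 0 (lshift n k) :> 'rV[R]_(n + n).
Proof.
apply/rowP => i; rewrite !mxE; case: splitP => j ij.
  by rewrite !mxE -!val_eqE /= ij.
rewrite !mxE -!val_eqE /= ij.
by rewrite gtn_eqF// (leq_trans (ltn_ord k)) ?leq_addr.
Qed.

Let continuous_row_mxl m1 m2 (y : 'rV[R]_m2) :
  continuous (fun x : 'rV[R]_m1 => row_mx x y).
Proof.
apply: continuous_rowP => i; case: (split_ordP i) => j ->.
  rewrite [X in continuous X](_ : _ = fun t : 'rV[R]_m1 => t ord0 j).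
    exact: coord_continuous.
  by apply/funext => t; rewrite /= row_mxEl.
rewrite [X in continuous X](_ : _ = cst (y ord0 j)).
  exact: cst_continuous.
by apply/funext => t; rewrite /= row_mxEr.
Qed.

Let continuous_row_mxr m1 m2 (x : 'rV[R]_m1) :
  continuous (fun y : 'rV[R]_m2 => row_mx x y).
Proof.
apply: continuous_rowP => i; case: (split_ordP i) => j ->.
  rewrite [X in continuous X](_ : _ = cst (x ord0 j)).
    exact: cst_continuous.
  by apply/funext => t; rewrite row_mxEl.
rewrite [X in continuous X](_ : _ = fun t : 'rV[R]_m2 => t ord0 j).
  exact: coord_continuous.
by apply/funext => t; rewrite row_mxEr.
Qed.

Let differentiable_mul x y : differentiable (mul x) y.
Proof.
pose L (y : 'rV[R]_n) : 'rV[R]_(n + n) := y *m row_mx 0 1%:M.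
have LE u : L u = row_mx 0 u by rewrite /L mul_mx_row mulmx0 mulmx1.
have -> : mul x = mulZ \o (fun u => L u + row_mx x 0).
  by apply/funext => u /=; rewrite mulZE LE add_row_mx add0r addr0.
apply: differentiable_comp; last exact: differentiable_mulZ.
apply: differentiableD; last exact: differentiable_cst.
have cL : continuous L.
  by rewrite (_ : L = row_mx 0); [exact: continuous_row_mxr|exact/funext/LE].
pose L' : {linear 'rV[R]_n -> 'rV[R]_(n + n)} := mulmxr (row_mx 0 1%:M).
by have := @linear_differentiable _ _ _ L' y cL.
Qed.

Let e1 (k : 'I_N) : 'rV[R]_n := delta_mx 0 (lshift (sumn Ns) k).

(** Left invariance determines the field from its value at 0. *)
Lemma sg_fieldE k x : X k x = 'D_(e1 k) (mul x) 0.
Proof.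
rewrite deriveE//.
by have := sg_left_invariant G k x 0; rewrite sg_field0 sg_mulx0.
Qed.

(* A partial derivative of the smooth map mulZ: the regularity of the field
   is read off from it along the section x |-> (x, 0). *)
Let F k := 'D_(delta_mx 0 (rshift n (lshift (sumn Ns) k))) mulZ.

Let FE k x : X k x = F k (row_mx x 0).
Proof.
rewrite sg_fieldE /F.
have -> : mul x = mulZ \o (fun y => row_mx x y).
  by apply/funext => u /=; rewrite mulZE.
by apply: derive_affine => h; rewrite row_mx_shiftr row_delta_r.
Qed.

Let F_C1 k : is_Ck 1 (F k).
Proof. by have [_] := sg_mul_smooth G 2; apply. Qed.

Let differentiable_F k z : differentiable (F k) z.
Proof. by have [] := F_C1 k. Qed.

Lemma sg_field_continuous k : continuous (X k).
Proof.
rewrite (_ : X k = F k \o (fun x => row_mx x 0)); last exact/funext/FE.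
move=> x; apply: continuous_comp; first exact: continuous_row_mxl.
exact/differentiable_continuous/differentiable_F.
Qed.

Let coordE (x : 'rV[R]_n) (k : 'I_N) (i j : 'I_n) :
  is_derive x (delta_mx 0 j) (fun x => X k x ord0 i)
    ('D_(delta_mx 0 (lshift n j)) (F k) (row_mx x 0) ord0 i).
Proof.
have -> : (fun x => X k x ord0 i) =
    (fun z => F k z ord0 i) \o (fun x => row_mx x 0).
  by apply/funext => u; rewrite /= FE.
have sE (h : R) : row_mx (h *: delta_mx 0 j + x) 0 =
    h *: delta_mx 0 (lshift n j) + row_mx x 0 :> 'rV[R]_(n + n).
  by rewrite row_mx_shiftl row_delta_l.
apply/(is_derive_affine (fun z => F k z ord0 i) _
  (phi := fun x => row_mx x 0) sE).
have dF : derivable (F k) (row_mx x 0) (delta_mx 0 (lshift n j)).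
  exact/diff_derivable/differentiable_F.
apply: DeriveDef; first by have /derivable_mxP := dF; apply.
by rewrite derive_mx// mxE.
Qed.

Lemma sg_field_derivable k i j x :
  derivable (fun x => X k x ord0 i) x (delta_mx 0 j).
Proof. by have [] := coordE x k i j. Qed.

Lemma sg_field_partial_continuous k i j :
  continuous (fun x => 'D_(delta_mx 0 j) (fun x => X k x ord0 i) x).
Proof.
rewrite (_ : (fun x => _) = (fun z : 'rV[R]_n => z ord0 i) \o
   ('D_(delta_mx 0 (lshift n j)) (F k)) \o (fun x => row_mx x 0)); last first.
  by apply/funext => x /=; have [_ ->] := coordE x k i j.
move=> x; apply: continuous_comp; first exact: continuous_row_mxl.
apply: continuous_comp; last exact: coord_continuous.
by have [_] := F_C1 k; apply.
Qed.

(** The field X_k has degree 1: differentiate the automorphism property of the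
    dilation along the curve t |-> t e_k at the origin. The i-th coefficient is
    thus homogeneous of degree weight i - 1. *)
Lemma sg_field_dilation k i (l : R) x : 0 < l ->
  l * X k (dilation l x) ord0 i = l ^+ weight i * X k x ord0 i.
Proof.
move=> l0; rewrite !sg_fieldE.
have dm y : derivable (mul y) 0 (e1 k)
  by exact/diff_derivable/differentiable_mul.
have dmi y : derivable (fun u => mul y u ord0 i) 0 (e1 k).
  by have /derivable_mxP := dm y; apply.
rewrite !derive_mx// !mxE.
have := derivableP (dmi (dilation l x)).
move=> /(is_derive_scale l); rewrite -{1}(dilationr0 l).
have le1 (h : R) :
    dilation l (h *: e1 k + 0) = h *: (l *: e1 k) + dilation l 0.
  by rewrite dilation_shift weight_lshift expr1.
move=> /(is_derive_affine _ _ le1)[_ <-].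
apply: etrans (deriveZ (l ^+ weight i) (dmi x)); congr (derive _ _ _).
apply/funext => u /=.
by rewrite -(sg_dilation G l0) dilationE.
Qed.

(** The coefficients of weight 1 are homogeneous of degree 0 and continuous at
    the origin, hence constant. *)
Lemma sg_field_stratum1 k l x :
  X k x ord0 (lshift (sumn Ns) l) = (k == l)%:R.
Proof.
pose g (s : R) := X k (dilation s x) ord0 (lshift (sumn Ns) l).
have : g 0 = X k x ord0 (lshift (sumn Ns) l).
  apply: continuous_pos_cst => [|s s0].
    apply: (@continuous_comp _ _ _ (fun s : R => dilation s x)
      (fun z => X k z ord0 (lshift (sumn Ns) l))).
      exact: continuous_dilation.
    apply: (@continuous_comp _ _ _ (X k)
      (fun z : 'rV[R]_n => z ord0 (lshift (sumn Ns) l))).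
      exact: sg_field_continuous.
    exact: coord_continuous.
  apply: (mulfI (lt0r_neq0 s0)).
  by rewrite sg_field_dilation// weight_lshift expr1.
move=> <-; rewrite /g dilation0 sg_field0 mxE eqxx /=.
by rewrite -val_eqE /= eq_sym.
Qed.

(** The derivative along x_j of the i-th coefficient is homogeneous of degree
    weight i - 1 - weight j, negative under the hypothesis; being continuous at
    the origin, it vanishes. For i = j this makes the fields divergence free. *)
Lemma sg_field_partial_eq0 k i j x : (weight i <= weight j)%N ->
  'D_(delta_mx 0 j) (fun x => X k x ord0 i) x = 0.
Proof.
move=> ij; pose a x := X k x ord0 i.
pose b := 'D_(delta_mx 0 j) a.
pose g (s : R) := s ^+ (weight j - weight i).+1 * b (dilation s x).
have gb : g 0 = b x.
  apply: continuous_pos_cst => [|s s0].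
    apply: cvgM; first exact: exprn_continuous.
    apply: (@continuous_comp _ _ _ (fun s : R => dilation s x) b).
      exact: continuous_dilation.
    exact: sg_field_partial_continuous.
  apply: (mulfI (lt0r_neq0 (exprn_gt0 (weight i) s0))).
  rewrite /g mulrA -exprD addnS subnKC// exprS -mulrA.
  have := derivableP (@sg_field_derivable k i j (dilation s x)).
  move=> /(is_derive_scale (s ^+ weight j)).
  have sE (h : R) := dilation_shift s h x j.
  move=> /(is_derive_affine _ _ sE)[da <-].
  have dZ c y := deriveZ c (@sg_field_derivable k i j y).
  apply: etrans (dZ _ _); apply: etrans (esym (deriveZ _ da)) _.
  congr (derive _ _ _).
  by apply/funext => u; exact: sg_field_dilation.
by rewrite -[LHS]/(b x) -gb /g expr0n mul0r.
Qed.

End stratified.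

(** * The modulus and the logarithmic weight *)

Section calculus.
Context {R : realType} {V : normedModType R}.

Lemma is_derive_chain (g : R -> R) (f : V -> R) (x v : V) (dg df : R) :
  is_derive (f x) 1 g dg -> is_derive x v f df ->
  is_derive x v (g \o f) (dg * df).
Proof.
move=> gf /is_derive_line fx; apply/is_derive_line.
apply: (@is_derive1_comp _ g (fun h : R => f (h *: v + x))) => //.
by rewrite scale0r add0r.
Qed.

Lemma is_derive_val (W : normedModType R) (f : V -> W) (x v : V) (df df' : W) :
  is_derive x v f df -> df = df' -> is_derive x v f df'.
Proof. by move=> ? <-. Qed.

Lemma is_derive_pow (f : V -> R) (x v : V) (n : nat) (df : R) :
  is_derive x v f df ->
  is_derive x v (fun y => f y ^+ n) (n%:R * f x ^+ n.-1 * df).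
Proof.
move=> fx; rewrite (_ : (fun y => _) = f ^+ n); first exact: is_deriveX.
by rewrite exprfctE.
Qed.

Lemma is_derive1_continuous (f : R -> R) (x df : R) :
  is_derive x 1 f df -> {for x, continuous f}.
Proof. by case=> /derivable1_diffP /differentiable_continuous. Qed.

(** At a double zero of h the difference quotient of the product is that of h
    times k, so continuity of k makes it tend to 0. *)
Lemma is_derive1_double_zero (h k : R -> R) :
  is_derive (0 : R) 1 h 0 -> h 0 = 0 -> {for 0, continuous k} ->
  is_derive (0 : R) 1 (fun t => h t * k t) 0.
Proof.
move=> [dh hE] h0 ck.
have cv : (fun t : R => t^-1 *:
      (((fun t => h t * k t) \o shift 0) (t *: 1) - h 0 * k 0))
    @ 0^' --> (0 : R).
  have e0 : 0 = 'D_1 h 0 * k 0 by rewrite hE mul0r.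
  rewrite [X in _ --> X]e0.
  rewrite (_ : (fun t => _) = (fun t : R =>
      (t^-1 *: ((h \o shift 0) (t *: 1) - h 0)) * k t)).
    apply: cvgM; first exact: dh.
    exact: cvg_within_filter ck.
  apply/funext => t /=; rewrite h0 mul0r !subr0 !addr0 [t *: 1]mulr1.
  by rewrite /GRing.scale /= mulrA.
by apply: DeriveDef; [apply/cvg_ex; exists 0|exact/cvg_lim].
Qed.

Definition modulus (a b : R) : R := Num.sqrt (a ^+ 2 + b ^+ 2).

Lemma modulus_ge0 a b : 0 <= modulus a b.
Proof. exact: sqrtr_ge0. Qed.

Lemma modulus_sqr a b : modulus a b ^+ 2 = a ^+ 2 + b ^+ 2.
Proof. by rewrite sqr_sqrtr// addr_ge0// sqr_ge0. Qed.

End calculus.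

Section modulus_power.
Context {R : realType}.

(* Where a + ib vanishes the modulus has a corner, but the power is the
   product of its square, which has a double zero, and a continuous factor. *)
Let modulusX1 (m : nat) (a b : R -> R) (da db : R) :
  is_derive (0 : R) 1 a da -> is_derive (0 : R) 1 b db ->
  is_derive (0 : R) 1 (fun y => modulus (a y) (b y) ^+ m.+2)
    (m.+2%:R * modulus (a 0) (b 0) ^+ m * (a 0 * da + b 0 * db)).
Proof.
move=> a0 b0.
have h0 : is_derive (0 : R) 1 (fun y => a y ^+ 2 + b y ^+ 2)
    (2 * (a 0 * da + b 0 * db)).
  apply: is_derive_eq.
  by rewrite /GRing.scale /=; ring.
have [ab|ab] := eqVneq (a 0 ^+ 2 + b 0 ^+ 2) 0.
  have [az bz] : a 0 = 0 /\ b 0 = 0.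
    move/eqP: ab; rewrite paddr_eq0 ?sqr_ge0// !sqrf_eq0.
    by move=> /andP[/eqP -> /eqP ->].
  rewrite az bz !mul0r addr0 mulr0.
  rewrite (_ : (fun y => _) = fun y =>
    (a y ^+ 2 + b y ^+ 2) * modulus (a y) (b y) ^+ m); last first.
    by apply/funext => y; rewrite -modulus_sqr -exprD.
  apply: is_derive1_double_zero => //.
    by move: h0; rewrite az bz !mul0r addr0 mulr0.
  apply: (@continuous_comp _ _ _ (fun y => modulus (a y) (b y))
    (fun y => y ^+ m)).
    apply: (@continuous_comp _ _ _ (fun y => a y ^+ 2 + b y ^+ 2) Num.sqrt).
      exact: is_derive1_continuous h0.
    exact: sqrt_continuous.
  exact: exprn_continuous.
have hp : 0 < a 0 ^+ 2 + b 0 ^+ 2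
  by rewrite lt_neqAle eq_sym ab addr_ge0// sqr_ge0.
have s0 : modulus (a 0) (b 0) != 0 by rewrite gt_eqF// sqrtr_gt0.
have := @is_derive_chain _ _ _ (fun y => a y ^+ 2 + b y ^+ 2) _ _ _ _
  (is_derive1_sqrt hp) h0.
rewrite -/(modulus (a 0) (b 0)) => dm.
apply: (is_derive_val (is_derive_pow m.+2 dm)).
rewrite /GRing.scale /= exprS -/(modulus (a 0) (b 0)); field.
exact: s0.
Qed.

Lemma is_derive_modulusX (V : normedModType R) (m : nat) (a b : V -> R)
    (x v : V) (da db : R) :
  is_derive x v a da -> is_derive x v b db ->
  is_derive x v (fun y => modulus (a y) (b y) ^+ m.+2)
    (m.+2%:R * modulus (a x) (b x) ^+ m * (a x * da + b x * db)).
Proof.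
move=> /is_derive_line ax /is_derive_line bx; apply/is_derive_line.
by have := modulusX1 m ax bx; rewrite scale0r add0r.
Qed.

End modulus_power.

Section weight_function.
Context {R : realType}.

(** A solution w of s w' + N w = (s ln (rho / s))^-N, which is what
    the divergence of w Y is for the radial field Y defined below. *)
Definition hardy_weight (N : nat) (rho s : R) : R :=
  s^-1 ^+ N * (ln (rho / s))^-1 ^+ N.-1 / N.-1%:R.

(** The derivative of the weight, written so that this equation is visible. *)
Definition hardy_weight' (N : nat) (rho s : R) : R :=
  s^-1 ^+ N * (ln (rho / s))^-1 ^+ N / s - N%:R * hardy_weight N rho s / s.

Lemma is_derive_hardy_weight N (rho s : R) : (1 < N)%N -> 0 < s < rho ->
  is_derive s 1 (hardy_weight N rho) (hardy_weight' N rho s).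
Proof.
case: N => [//|[//|m]] _ /andP[s0 sr].
have r0 : 0 < rho by exact: lt_trans sr.
have rs : 1 < rho / s by rewrite ltr_pdivlMr// mul1r.
have L0 : 0 < ln (rho / s) by rewrite ln_gt0.
have di : is_derive s 1 (fun s => s^-1) (- s ^- 2).
  have := @is_deriveV R id s 1 1 (lt0r_neq0 s0) (is_derive_id _ _).
  by rewrite /GRing.scale /= mulr1.
have dL : is_derive s 1 (fun s => ln (rho / s)) (- s^-1).
  have dq : is_derive s 1 (fun s => rho * s^-1) (rho * - s ^- 2).
    exact: (@is_deriveZ _ _ _ (fun s : R => s^-1) rho s 1 _ di).
  have q0 : 0 < rho * s^-1 by rewrite divr_gt0.
  have := @is_derive_chain R R (@ln R) (fun s : R => rho * s^-1) _ _ _ _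
    (is_derive1_ln q0) dq.
  move=> /is_derive_val; apply; field.
  by rewrite !gt_eqF.
have dl : is_derive s 1 (fun s => (ln (rho / s))^-1)
    ((ln (rho / s)) ^- 2 * s^-1).
  have := @is_deriveV R _ s _ 1 (lt0r_neq0 L0) dL.
  by rewrite /GRing.scale /= mulrNN.
have dim := is_derive_pow m.+2 di.
have dlm := is_derive_pow m.+1 dl.
have -> : hardy_weight m.+2 rho = m.+1%:R^-1 *:
    ((fun y : R => y^-1 ^+ m.+2) * (fun y => (ln (rho / y))^-1 ^+ m.+1)).
  by apply/funext => y; rewrite /hardy_weight /= /GRing.scale /= mulrC.
apply: (is_derive_val (is_deriveZ _ (is_deriveM dim dlm))).
rewrite /hardy_weight' /hardy_weight /GRing.scale /= !exprS.
field; rewrite !gt_eqF//= ltr_pwDl// ler0n.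
Qed.

Lemma continuous_hardy_weight N (rho s : R) : (1 < N)%N -> 0 < s < rho ->
  {for s, continuous (hardy_weight N rho)}.
Proof.
move=> N1 srho.
exact: is_derive1_continuous (is_derive_hardy_weight N1 srho).
Qed.

Lemma continuous_ln_quotient (rho s : R) : 0 < s < rho ->
  {for s, continuous (fun s : R => ln (rho / s))}.
Proof.
move=> /andP[s0 sr]; have r0 : 0 < rho by exact: lt_trans sr.
apply: (@continuous_comp _ _ _ (fun s : R => rho / s) (@ln R)).
  apply: cvgM; first exact: cvg_cst.
  by apply: cvgV; [rewrite gt_eqF|].
by apply: continuous_ln; rewrite divr_gt0.
Qed.

Lemma ln_quotient_gt0 (rho s : R) : 0 < s < rho -> 0 < ln (rho / s).
Proof. by move=> /andP[s0 sr]; rewrite ln_gt0// ltr_pdivlMr// mul1r. Qed.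

Lemma continuous_hardy_weight' N (rho s : R) : (1 < N)%N -> 0 < s < rho ->
  {for s, continuous (hardy_weight' N rho)}.
Proof.
move=> N1 srho; have L0 := ln_quotient_gt0 srho.
have s0 : s != 0 by case/andP: srho => /gt_eqF ->.
have ci : {for s, continuous (fun s : R => s^-1)} by exact: cvgV.
apply: cvgB; apply: cvgM => //.
  apply: cvgM.
    exact: (continuous_comp ci (@exprn_continuous _ _ _)).
  apply: (@continuous_comp _ _ _ (fun s : R => (ln (rho / s))^-1)
    (fun y => y ^+ N)).
    by apply: cvgV; [rewrite gt_eqF|exact: continuous_ln_quotient].
  exact: exprn_continuous.
by apply: cvgM; [exact: cvg_cst|exact: continuous_hardy_weight].
Qed.

End weight_function.

(** * The pointwise inequality *)

Section pointwise.
Context {R : realType}.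

(** The weighted arithmetic-geometric mean inequality with weights n and 1:
    this convexity takes the place of the Hoelder inequality. *)
Lemma bernoulli_homogeneous (n : nat) (a b : R) : 0 <= a -> 0 <= b ->
  n.+1%:R * a ^+ n * b <= n%:R * a ^+ n.+1 + b ^+ n.+1.
Proof.
move=> a0 b0; elim: n => [|n ih]; first by rewrite !expr0 mul0r add0r !mul1r.
have {}ih := ler_wpM2l b0 ih.
have sq : 0 <= n.+1%:R * a ^+ n * (a - b) ^+ 2.
  by rewrite mulr_ge0 ?sqr_ge0// mulr_ge0// exprn_ge0.
rewrite -subr_ge0; move: ih; rewrite -subr_ge0 => ih.
apply: le_trans (addr_ge0 ih sq) _.
rewrite -(natr1 n.+1) -(natr1 n) !exprS le_eqVlt; apply/orP; left.
by apply/eqP; ring.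
Qed.

Lemma cauchy_schwarz2 (u v p q : R) :
  - (modulus u v * modulus p q) <= u * p + v * q.
Proof.
rewrite -[leRHS]opprK lerN2.
have [le0|/ltW ge0] := leP (- (u * p + v * q)) 0.
  by rewrite (le_trans le0)// mulr_ge0 ?modulus_ge0.
rewrite -(@ler_pXn2r _ 2)// ?nnegrE// ?mulr_ge0 ?modulus_ge0//.
rewrite exprMn !modulus_sqr -subr_ge0.
rewrite (_ : _ - _ = (u * q - v * p) ^+ 2) ?sqr_ge0//; ring.
Qed.

(** Here s stands for |x'|, u + iv for f and p + iq for Y f, so that the right
    side is N times the divergence of |f|^N w Y. The part without derivatives
    is A^N with A = |f| / (s L), the other part is at least
    - A^(N-1) b with b = N / (N - 1) |Y f| / s by the Cauchy-Schwarz
    inequality, and the arithmetic-geometric mean inequality concludes. *)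
Lemma hardy_pointwise (N : nat) (rho s u v p q : R) : (1 < N)%N ->
  0 < s < rho ->
  (modulus u v / (s * ln (rho / s))) ^+ N
    - (N%:R / (N%:R - 1) * (modulus p q / s)) ^+ N <=
  N%:R * (N%:R * (modulus u v ^+ N * hardy_weight N rho s) +
    (hardy_weight N rho s * (N%:R * modulus u v ^+ N.-2 * (u * p + v * q)) +
     modulus u v ^+ N * (hardy_weight' N rho s * s))).
Proof.
case: N => [//|[//|m]] _ srho; have L0 := ln_quotient_gt0 srho.
have s0 : 0 < s by case/andP: srho.
set L := ln (rho / s) in L0 *; set r := modulus u v; set B := modulus p q.
have r0 : 0 <= r := modulus_ge0 _ _; have B0 : 0 <= B := modulus_ge0 _ _.
set A := r / (s * L); set b := _ / _ * _.
have N1 : m.+2%:R - 1 = m.+1%:R :> R by rewrite -natr1 addrK.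
have A0 : 0 <= A by rewrite divr_ge0// mulr_ge0// ltW.
have b0 : 0 <= b by rewrite /b N1 mulr_ge0 ?divr_ge0// ltW.
have cs : 0 <= hardy_weight m.+2 rho s *
    (m.+2%:R * r ^+ m * (u * p + v * q + r * B)).
  rewrite mulr_ge0//.
    by rewrite /hardy_weight -/L divr_ge0// mulr_ge0// exprn_ge0// invr_ge0 ltW.
  by rewrite mulr_ge0 ?mulr_ge0 ?exprn_ge0// -lerBlDr sub0r cauchy_schwarz2.
have bern := bernoulli_homogeneous m.+1 A0 b0.
apply: le_trans (_ : m.+2%:R * (A ^+ m.+2 - A ^+ m.+1 * b) <= _).
  move: bern; rewrite -(natr1 m.+1); lra.
rewrite ler_wpM2l// -subr_ge0; apply: le_trans cs _.
rewrite le_eqVlt; apply/orP; left; apply/eqP.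
rewrite /hardy_weight' /hardy_weight -/L /A /b N1 /=.
rewrite !expr_div_n !exprMn !exprVn !exprS.
field.
by rewrite !gt_eqF//= ?ltr_pwDl// ?exprn_gt0.
Qed.

End pointwise.

(** * Continuity at a point *)

Section pointwise_continuity.
Context {R : realType} {T : topologicalType}.
Implicit Types (f g : T -> R) (x : T).

Lemma continuous_at_cst (c : R) x : {for x, continuous (fun _ : T => c)}.
Proof. exact: cst_continuous. Qed.

Lemma continuous_at_add f g x : {for x, continuous f} ->
  {for x, continuous g} -> {for x, continuous (fun y => f y + g y)}.
Proof. exact: cvgD. Qed.

Lemma continuous_at_mul f g x : {for x, continuous f} ->
  {for x, continuous g} -> {for x, continuous (fun y => f y * g y)}.
Proof. exact: cvgM. Qed.

Lemma continuous_at_inv f x : f x != 0 -> {for x, continuous f} ->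
  {for x, continuous (fun y => (f y)^-1)}.
Proof. exact: cvgV. Qed.

Lemma continuous_at_pow m f x : {for x, continuous f} ->
  {for x, continuous (fun y => f y ^+ m)}.
Proof. by move=> fx; exact: (continuous_comp fx (@exprn_continuous _ _ _)). Qed.

Lemma continuous_at_modulus f g x : {for x, continuous f} ->
  {for x, continuous g} -> {for x, continuous (fun y => modulus (f y) (g y))}.
Proof.
move=> fx gx.
apply: (@continuous_comp _ _ _ (fun y => f y ^+ 2 + g y ^+ 2) Num.sqrt).
  by apply: continuous_at_add; exact: continuous_at_pow.
exact: sqrt_continuous.
Qed.

Lemma continuous_at_sum (I : finType) (g : I -> T -> R) x :
  (forall i, {for x, continuous (g i)}) ->
  {for x, continuous (fun y => \sum_i g i y)}.
Proof.
move=> gx; rewrite (_ : (fun y => _) = \sum_i g i); last first.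
  by apply/funext => y; rewrite fct_sumE.
elim/big_ind: _ => [|f1 f2 h1 h2|i _]; [exact: cst_continuous| |exact: gx].
by apply: cvgD; [exact: h1|exact: h2].
Qed.

Lemma continuous_supported (K : set T) g :
  closed K -> (forall x, K x -> {for x, continuous g}) ->
  (forall x, ~ K x -> g x = 0) -> continuous g.
Proof.
move=> cK gK g0 x; have [Kx|nKx] := pselect (K x); first exact: gK.
rewrite /continuous_at g0//; apply: cvg_near_cst.
have oK : open (~` K) by exact: closed_openC.
by apply: filterS (open_nbhs_nbhs (conj oK nKx)) => y; exact: g0.
Qed.

End pointwise_continuity.

(** * The norm of the first stratum *)

Section radial.
Context {R : realType}.

Lemma is_derive_coord n (x w : 'rV[R]_n) i :
  is_derive x w (fun y : 'rV[R]_n => y ord0 i) (w ord0 i).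
Proof.
have dx := @derivable_id _ _ x w.
apply: DeriveDef; first by have /derivable_mxP := dx; apply.
by have := derive_id x w; rewrite (derive_mx dx) => {2}<-; rewrite mxE.
Qed.

Lemma derive_partials n (u : 'rV[R]_n -> R) (x w : 'rV[R]_n) :
  differentiable u x ->
  'D_w u x = \sum_i w ord0 i * 'D_(delta_mx 0 i) u x.
Proof.
move=> du; rewrite deriveE// {1}(row_sum_delta w) linear_sum.
apply: eq_bigr => i _. rewrite linearZ deriveE//.
Qed.

Lemma derive_near0 (V : normedModType R) (g : V -> R) (x w : V) :
  (\near x, g x = 0) -> 'D_w g x = 0.
Proof.
by move=> g0; rewrite -(derive_cst (0 : R) x w); exact: near_eq_derive.
Qed.

Lemma enorm_ge0 n (x : 'rV[R]_n) : 0 <= enorm x.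
Proof. exact: sqrtr_ge0. Qed.

Lemma enorm_sqr n (x : 'rV[R]_n) : enorm x ^+ 2 = \sum_i x ord0 i ^+ 2.
Proof. by rewrite sqr_sqrtr// sumr_ge0// => i _; exact: sqr_ge0. Qed.

Lemma continuous_enorm_stratum1 N m :
  continuous (fun x : 'rV[R]_(N + m) => enorm (stratum1 x)).
Proof.
move=> x.
apply: (@continuous_comp _ _ _
    (fun x : 'rV[R]_(N + m) => \sum_i stratum1 x ord0 i ^+ 2) Num.sqrt).
  apply: continuous_at_sum => i.
  apply: (@continuous_comp _ _ _
    (fun x : 'rV[R]_(N + m) => stratum1 x ord0 i) (fun y => y ^+ 2)).
    rewrite (_ : (fun y => _) = fun y : 'rV[R]_(N + m) => y ord0 (lshift m i)).
      exact: coord_continuous.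
    by apply/funext => y; rewrite mxE.
  exact: exprn_continuous.
exact: sqrt_continuous.
Qed.

Lemma is_derive_enorm_stratum1 N m (x w : 'rV[R]_(N + m)) :
  0 < enorm (stratum1 x) ->
  is_derive x w (fun y : 'rV[R]_(N + m) => enorm (stratum1 y))
    ((\sum_i stratum1 x ord0 i * stratum1 w ord0 i) / enorm (stratum1 x)).
Proof.
move=> x0.
have h0 : 0 < \sum_i stratum1 x ord0 i ^+ 2 by rewrite -enorm_sqr exprn_gt0.
have dh : is_derive x w
    (fun y : 'rV[R]_(N + m) => \sum_i stratum1 y ord0 i ^+ 2)
    (\sum_i 2 * stratum1 x ord0 i * stratum1 w ord0 i).
  rewrite (_ : (fun y => _) = \sum_(i < N)
      (fun y : 'rV[R]_(N + m) => stratum1 y ord0 i ^+ 2)); last first.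
    by apply/funext => y; rewrite fct_sumE.
  apply: is_derive_sum => i.
  rewrite (_ : (fun y => _) =
      fun y : 'rV[R]_(N + m) => y ord0 (lshift m i) ^+ 2); last first.
    by apply/funext => y; rewrite mxE.
  have := is_derive_pow 2 (is_derive_coord x w (lshift m i)).
  by rewrite !mxE expr1.
apply: (is_derive_val (is_derive_chain (is_derive1_sqrt h0) dh)).
rewrite -/(enorm (stratum1 x)).
rewrite (_ : \sum_i 2 * _ * _ =
    2 * \sum_i stratum1 x ord0 i * stratum1 w ord0 i); last first.
  by rewrite mulr_sumr; apply: eq_bigr => i _; rewrite mulrA.
by field; rewrite gt_eqF.
Qed.

End radial.

(** * The divergence identity *)

Section hardy.
Context {R : realType} {N : nat} {Ns : seq nat} (G : stratified_group R N Ns).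
Local Notation n := (N + sumn Ns)%N.
Local Notation X := (sg_field G).
Local Notation e_ i := (delta_mx (0 : 'I_1) (i : 'I_n) : 'rV[R]_n).

(** The horizontal analogue of the Euler field of the first stratum. *)
Definition radial_field (x : 'rV[R]_n) : 'rV[R]_n :=
  \sum_k stratum1 x ord0 k *: X k x.

Lemma stratum1E (x : 'rV[R]_n) k :
  stratum1 x ord0 k = x ord0 (lshift (sumn Ns) k).
Proof. by rewrite mxE. Qed.

Lemma radial_field_coord x i :
  radial_field x ord0 i = \sum_k x ord0 (lshift (sumn Ns) k) * X k x ord0 i.
Proof. by rewrite summxE; apply: eq_bigr => k _; rewrite mxE stratum1E. Qed.

(** The field acts on functions of x' as the Euler field of the first
    stratum does. *)
Lemma radial_field_stratum1 x : stratum1 (radial_field x) = stratum1 x.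
Proof.
apply/rowP => l; rewrite !stratum1E radial_field_coord (bigD1 l)//=.
rewrite sg_field_stratum1 eqxx mulr1 big1 ?addr0// => k kl.
by rewrite sg_field_stratum1 (negPf kl) mulr0.
Qed.

(** Summed over i this gives divergence N: only the first-stratum coordinates
    contribute, as X_k^i does not depend on x_i. *)
Lemma radial_field_divergence x i :
  is_derive x (e_ i) (fun y => radial_field y ord0 i) ((i < N)%N%:R).
Proof.
rewrite (_ : (fun y => _) = \sum_k
    ((fun y : 'rV[R]_n => y ord0 (lshift (sumn Ns) k)) *
     (fun y => X k y ord0 i))); last first.
  by apply/funext => y; rewrite radial_field_coord fct_sumE.
have dX k : is_derive x (e_ i) (fun y => X k y ord0 i) 0.
  apply: DeriveDef; first exact: sg_field_derivable.
  by apply: sg_field_partial_eq0.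
apply: (is_derive_val (is_derive_sum
  (fun k => is_deriveM (is_derive_coord x (e_ i) (lshift (sumn Ns) k))
    (dX k)))).
under eq_bigr do rewrite scaler0 add0r mxE eqxx /=.
case: (split_ordP i) => j ->.
  rewrite /= (bigD1 j)//= eqxx sg_field_stratum1 eqxx big1 ?addr0.
    by rewrite /GRing.scale /= mulr1.
  move=> k kj; rewrite (inj_eq (@lshift_inj _ _)) eq_sym sg_field_stratum1.
  by rewrite (negPf kj) scale0r.
rewrite /= big1// => k _.
by rewrite eq_lrshift mulr0n scaler0.
Qed.

(* u + iv is a function with support in K, on which the weight is smooth. *)
Context (rho : R) (u v : 'rV[R]_n -> R) (K : set 'rV[R]_n) (M : R).
Context (N1 : (1 < N)%N) (uC1 : is_Ck 1 u) (vC1 : is_Ck 1 v)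
  (clK : closed K)
  (Krad : forall x, K x -> 0 < enorm (stratum1 x) < rho)
  (Koff : forall x, ~ K x -> u x = 0 /\ v x = 0)
  (Kbnd : forall (x : 'rV[R]_n) i, M < `|x ord0 i| -> ~ K x).

Let du x : differentiable u x. Proof. by case: uC1. Qed.
Let dv x : differentiable v x. Proof. by case: vC1. Qed.

Let s (x : 'rV[R]_n) := enorm (stratum1 x).
Let r x := modulus (u x) (v x).
Let phi x := r x ^+ N * hardy_weight N rho (s x).
(* The derivative of phi along w; off K the weight may be singular, but
   there the formula vanishes together with phi. *)
Let dphi x w :=
  r x ^+ N * (hardy_weight' N rho (s x) *
    ((\sum_k stratum1 x ord0 k * stratum1 w ord0 k) / s x)) +
  hardy_weight N rho (s x) *
    (N%:R * r x ^+ N.-2 * (u x * 'D_w u x + v x * 'D_w v x)).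

Let near_off x : ~ K x -> \near x, ~ K (x : 'rV[R]_n).
Proof.
by move=> nK; apply: open_nbhs_nbhs; split => //; exact: closed_openC.
Qed.

Let r_off x : ~ K x -> r x = 0.
Proof.
by move=> /Koff[ux vx]; rewrite /r /modulus ux vx expr0n addr0 sqrtr0.
Qed.

Let N0 : (0 < N)%N. Proof. exact: ltnW. Qed.

Let phi_off x : ~ K x -> phi x = 0.
Proof. by move=> Kx; rewrite /phi r_off// expr0n gtn_eqF// mul0r. Qed.

Let dphi_off x w : ~ K x -> dphi x w = 0.
Proof.
move=> Kx; have [ux vx] := Koff Kx.
by rewrite /dphi r_off// expr0n gtn_eqF// ux vx !mul0r addr0 !mulr0 addr0.
Qed.

Let D_off x w : ~ K x -> 'D_w u x = 0 /\ 'D_w v x = 0.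
Proof.
move=> Kx; split; apply: derive_near0.
  by apply: filterS (near_off Kx) => y /Koff[].
by apply: filterS (near_off Kx) => y /Koff[].
Qed.

Let is_derive_phi x w : is_derive x w phi (dphi x w).
Proof.
have [Kx|Kx] := pselect (K x); last first.
  rewrite dphi_off//.
  apply: near_eq_is_derive (is_derive_cst (0 : R) x w).
  by apply: filterS (near_off Kx) => y Ky; rewrite phi_off.
have /andP[s0 srho] := Krad Kx.
have dm := is_derive_modulusX N.-2
  (derivableP (@diff_derivable _ _ _ _ _ w (du x)))
  (derivableP (@diff_derivable _ _ _ _ _ w (dv x))).
have N2 : N.-2.+2 = N by case: N N1 => [//|[]].
have dw := @is_derive_chain _ _ (hardy_weight N rho) s _ _ _ _
  (is_derive_hardy_weight N1 (Krad Kx)) (is_derive_enorm_stratum1 w s0).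
rewrite N2 in dm.
apply: (is_derive_val (is_deriveM dm dw)).
by [].
Qed.

Let cu : continuous u.
Proof. by move=> x; exact: differentiable_continuous. Qed.
Let cv : continuous v.
Proof. by move=> x; exact: differentiable_continuous. Qed.
Let cs : continuous s. Proof. exact: continuous_enorm_stratum1. Qed.

Let cr x : {for x, continuous r}.
Proof. by apply: continuous_at_modulus; [exact: cu|exact: cv]. Qed.

Let c_weight x : K x -> {for x, continuous (fun y => hardy_weight N rho (s y))}.
Proof.
move=> Kx; apply: (@continuous_comp _ _ _ s (hardy_weight N rho)).
  exact: cs.
exact/continuous_hardy_weight/Krad.
Qed.

Let phi_continuous : continuous phi.
Proof.
apply: (continuous_supported clK); last exact: phi_off.
move=> x Kx; apply: continuous_at_mul; last exact: c_weight.
by apply: continuous_at_pow; exact: cr.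
Qed.

Let dphi_continuous i : continuous (fun x => dphi x (e_ i)).
Proof.
apply: (continuous_supported clK); last by move=> x; exact: dphi_off.
move=> x Kx; have /andP[s0 srho] := Krad Kx.
apply: continuous_at_add; apply: continuous_at_mul.
- by apply: continuous_at_pow; exact: cr.
- apply: continuous_at_mul.
    apply: (@continuous_comp _ _ _ s (hardy_weight' N rho)); first exact: cs.
    exact/continuous_hardy_weight'/Krad.
  apply: continuous_at_mul; last first.
    by apply: continuous_at_inv; [rewrite gt_eqF|exact: cs].
  apply: continuous_at_sum => k.
  apply: continuous_at_mul; last exact: continuous_at_cst.
  rewrite [X in {for _, continuous X}](_ : _ =
      fun y : 'rV[R]_n => y ord0 (lshift (sumn Ns) k)).
    exact: coord_continuous.
  by apply/funext => y; rewrite stratum1E.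
- exact: c_weight.
apply: continuous_at_mul.
  apply: continuous_at_mul; first exact: continuous_at_cst.
  by apply: continuous_at_pow; exact: cr.
apply: continuous_at_add; apply: continuous_at_mul.
- exact: cu.
- by have [_ /(_ i)] := uC1; apply.
- exact: cv.
- by have [_ /(_ i)] := vC1; apply.
Qed.

Let cY i : continuous (fun x => radial_field x ord0 i).
Proof.
rewrite [X in continuous X](_ : _ = fun y : 'rV[R]_n =>
    \sum_k y ord0 (lshift (sumn Ns) k) * X k y ord0 i).
  move=> x; apply: continuous_at_sum => k.
  apply: continuous_at_mul; first exact: coord_continuous.
  apply: (@continuous_comp _ _ _ (X k) (fun z : 'rV[R]_n => z ord0 i)).
    exact: sg_field_continuous.
  exact: coord_continuous.
by apply/funext => y; exact: radial_field_coord.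
Qed.

(* The i-th component of phi Y and its derivative along x_i. *)
Let flux i x := radial_field x ord0 i * phi x.

Let dflux i x := radial_field x ord0 i * dphi x (e_ i) + phi x * (i < N)%N%:R.

Let is_derive_flux i x : is_derive x (e_ i) (flux i) (dflux i x).
Proof.
exact: (is_deriveM (radial_field_divergence x i) (is_derive_phi x (e_ i))).
Qed.

Let dflux_continuous i : continuous (dflux i).
Proof.
rewrite /dflux; suff c x : {for x, continuous (dflux i)} by exact: c.
apply: continuous_at_add; apply: continuous_at_mul.
- exact: cY.
- exact: dphi_continuous.
- exact: phi_continuous.
- exact: continuous_at_cst.
Qed.

Let dflux_integrable i : (lebesgue_rV n).-integrable setT (EFin \o dflux i).
Proof.
apply: (continuous_cpt_integrable (M := M)); first exact: dflux_continuous.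
move=> x j /Kbnd Kx.
by rewrite /dflux dphi_off// phi_off// mulr0 mul0r addr0.
Qed.

Let integral_dflux i : (\int[lebesgue_rV n]_x (dflux i x)%:E = 0)%E.
Proof.
have dE x : 'D_(e_ i) (flux i) x = dflux i x by exact: derive_val.
rewrite -[RHS](@integral_partial_eq0 R n i (flux i) M).
- by apply: eq_integral => x _; rewrite dE.
- by move=> x; have [] := is_derive_flux i x.
- rewrite (_ : (fun x => _) = dflux i); last exact/funext/dE.
  exact: dflux_continuous.
- by move=> x j /Kbnd Kx; rewrite /flux phi_off// mulr0.
Qed.

Let dphi_radial x :
  N%:R * phi x + dphi x (radial_field x) = \sum_i dflux i x.
Proof.
rewrite big_split/= addrC -mulr_sumr; congr (_ + _).
  rewrite mulrC; congr (_ * _).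
  rewrite big_split_ord /= (eq_bigr (fun=> 1)) => [|i _]; last first.
    by rewrite ltn_ord.
  rewrite sumr_const card_ord big1 ?addr0// => i _.
  by rewrite ltnNge leq_addr.
rewrite /dphi (derive_partials _ (du x)) (derive_partials _ (dv x)).
under [in RHS]eq_bigr do rewrite mulrDr.
rewrite big_split/=; congr (_ + _).
  transitivity (r x ^+ N * (hardy_weight' N rho (s x) *
      ((\sum_i radial_field x ord0 i *
         \sum_k stratum1 x ord0 k * stratum1 (e_ i) ord0 k) / s x))).
    congr (_ * (_ * (_ / _))).
    under [in RHS]eq_bigr do rewrite mulr_sumr.
    rewrite exchange_big /=; apply: eq_bigr => k _.
    rewrite (bigD1 (lshift (sumn Ns) k))//= big1 ?addr0 => [|i ik].
      by rewrite !stratum1E mxE !eqxx /= mulr1 mulrC.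
    by rewrite !stratum1E mxE eqxx eq_sym (negPf ik) !mulr0.
  by rewrite mulr_suml !mulr_sumr; apply: eq_bigr => i _; ring.
rewrite !mulr_sumr -big_split/= !mulr_sumr; apply: eq_bigr => i _; ring.
Qed.

Let divergence_radial_eq0 :
  (\int[lebesgue_rV n]_x (\sum_i dflux i x)%:E = 0)%E.
Proof.
under eq_integral do rewrite -sumEFin.
rewrite integral_sum//.
by rewrite big1// => i _; exact: integral_dflux.
Qed.

Let p x := 'D_(radial_field x) u x.
Let q x := 'D_(radial_field x) v x.

Let lhs x := (r x / (s x * ln (rho / s x))) ^+ N.
Let rhs x := (modulus (p x) (q x) / s x) ^+ N.

Let lhs_off x : ~ K x -> lhs x = 0.
Proof. by move=> Kx; rewrite /lhs r_off// mul0r expr0n gtn_eqF. Qed.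

Let rhs_off x : ~ K x -> rhs x = 0.
Proof.
move=> Kx; have [p0 q0] := D_off (radial_field x) Kx.
by rewrite /rhs /p /q p0 q0 /modulus expr0n addr0 sqrtr0 mul0r expr0n gtn_eqF.
Qed.

Let c_radialD (g : 'rV[R]_n -> R) : is_Ck 1 g ->
  continuous (fun x => 'D_(radial_field x) g x).
Proof.
move=> [dg cg]; rewrite [X in continuous X](_ : _ = fun x =>
    \sum_i radial_field x ord0 i * 'D_(e_ i) g x); last first.
  by apply/funext => x; exact: derive_partials.
move=> x; apply: continuous_at_sum => i.
apply: continuous_at_mul; first exact: cY.
exact: cg.
Qed.

Let lhs_integrable : (lebesgue_rV n).-integrable setT (EFin \o lhs).
Proof.
apply: (continuous_cpt_integrable (M := M)); last first.
  by move=> x j /Kbnd; exact: lhs_off.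
apply: (continuous_supported clK); last exact: lhs_off.
move=> x Kx; have /andP[s0 srho] := Krad Kx; apply: continuous_at_pow.
apply: continuous_at_mul; first exact: cr.
apply: continuous_at_inv.
  by rewrite mulf_neq0// gt_eqF// ln_quotient_gt0// Krad.
apply: continuous_at_mul; first exact: cs.
apply: (@continuous_comp _ _ _ s (fun y => ln (rho / y))); first exact: cs.
exact/continuous_ln_quotient/Krad.
Qed.

Let rhs_integrable : (lebesgue_rV n).-integrable setT (EFin \o rhs).
Proof.
apply: (continuous_cpt_integrable (M := M)); last first.
  by move=> x j /Kbnd; exact: rhs_off.
apply: (continuous_supported clK); last exact: rhs_off.
move=> x Kx; have /andP[s0 srho] := Krad Kx; apply: continuous_at_pow.
apply: continuous_at_mul.
  by apply: continuous_at_modulus; exact: c_radialD.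
by apply: continuous_at_inv; [rewrite gt_eqF|exact: cs].
Qed.

Let c : R := (N%:R / (N%:R - 1)) ^+ N.

Let hardy_lhs_rhs :
  (\int[lebesgue_rV n]_x (lhs x)%:E <=
   c%:E * \int[lebesgue_rV n]_x (rhs x)%:E)%E.
Proof.
pose dv_ x := N%:R * \sum_i dflux i x.
have isum : (lebesgue_rV n).-integrable setT (fun x => \sum_i (dflux i x)%:E)%E.
  by apply: integrable_sum => // i _; exact: dflux_integrable.
have idv : (lebesgue_rV n).-integrable setT (EFin \o dv_).
  rewrite (_ : _ \o _ = fun x =>
    (N%:R%:E * \sum_i (dflux i x)%:E)%E); last first.
    by apply/funext => x; rewrite sumEFin.
  exact: integrableZl.
have dv0 : (\int[lebesgue_rV n]_x (dv_ x)%:E = 0)%E.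
  under eq_integral do rewrite EFinM.
  rewrite integralZl//.
    by rewrite divergence_radial_eq0 mule0.
  rewrite (_ : (fun x => _) = fun x => (\sum_i (dflux i x)%:E)%E); last first.
    by apply/funext => x; rewrite sumEFin.
  exact: isum.
have icr : (lebesgue_rV n).-integrable setT (fun x => c%:E * (rhs x)%:E)%E.
  exact: integrableZl.
have -> : (c%:E * \int[lebesgue_rV n]_x (rhs x)%:E =
    \int[lebesgue_rV n]_x ((dv_ x)%:E + c%:E * (rhs x)%:E))%E.
  by rewrite integralD// dv0 add0e integralZl.
apply: le_integral => //; first exact: integrableD.
move=> x _; rewrite -EFinM -EFinD lee_fin -lerBlDr.
have [Kx|Kx] := pselect (K x); last first.
  rewrite lhs_off// rhs_off// mulr0 subr0 le_eqVlt; apply/orP; left; apply/eqP.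
  by rewrite /dv_ -dphi_radial (phi_off Kx) (dphi_off _ Kx) mulr0 addr0 mulr0.
have := hardy_pointwise (u x) (v x) (p x) (q x) N1 (Krad Kx).
rewrite [X in _ - X <= _]exprMn.
have sN : s x != 0 by have /andP[/gt_eqF ->] := Krad Kx.
move=> /le_trans; apply; rewrite /dv_ -dphi_radial /dphi /phi.
have -> : (\sum_k stratum1 x ord0 k * stratum1 (radial_field x) ord0 k) / s x =
    s x.
  rewrite radial_field_stratum1.
  have -> : \sum_k stratum1 x ord0 k * stratum1 x ord0 k = s x ^+ 2.
    by rewrite /s enorm_sqr; apply: eq_bigr => k _; rewrite expr2.
  by rewrite expr2 mulfK.
rewrite le_eqVlt; apply/orP; left; apply/eqP; congr (_ * (_ + _)).
by rewrite addrC.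
Qed.

(** The divergence of phi Y integrates to 0, so integrating hardy_pointwise
    leaves the inequality between the N-th powers of the two norms. *)
Lemma hardy_integral_power :
  (\int[lebesgue_rV n]_x
      ((modulus (u x) (v x) / (enorm (stratum1 x) *
         ln (rho / enorm (stratum1 x)))) ^+ N)%:E <=
   ((N%:R / (N%:R - 1)) ^+ N)%:E *
   \int[lebesgue_rV n]_x
      ((modulus ('D_(radial_field x) u x) ('D_(radial_field x) v x) /
         enorm (stratum1 x)) ^+ N)%:E)%E.
Proof. exact: hardy_lhs_rhs. Qed.

End hardy.

(** * The Hardy inequality *)

Section norms.
Context {R : realType}.

Lemma normc_modulus (z : R[i]) :
  ComplexField.Normc.normc z = modulus (complex.Re z) (complex.Im z).
Proof. by case: z. Qed.

Lemma normcR (a : R) : 0 <= a -> ComplexField.Normc.normc a%:C%C = a.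
Proof.
move=> a0; rewrite normc_modulus /modulus /= expr0n addr0.
by rewrite sqrtr_sqr ger0_norm.
Qed.

Lemma modulusMr (a b c : R) : 0 <= c ->
  modulus (a * c) (b * c) = modulus a b * c.
Proof.
move=> c0; rewrite /modulus !exprMn -mulrDl sqrtrM ?addr_ge0 ?sqr_ge0//.
by rewrite sqrtr_sqr ger0_norm.
Qed.

Lemma normr_coord_le n (x : 'rV[R]_n) i : `|x ord0 i| <= `|x|.
Proof.
rewrite [leRHS]/Num.Def.normr /= mx_normrE.
exact: (le_bigmax _ (fun j : 'I_1 * 'I_n => `|x j.1 j.2|) (ord0, i)).
Qed.

Lemma enorm_gt0 n (x : 'rV[R]_n) : x != 0 -> 0 < enorm x.
Proof.
move=> x0; rewrite lt_neqAle enorm_ge0 andbT eq_sym.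
apply: contra x0 => /eqP e0.
have : \sum_i x ord0 i ^+ 2 = 0 by rewrite -enorm_sqr e0 expr0n.
move/psumr_eq0P => z; apply/eqP/rowP => i; rewrite mxE.
by apply/eqP; rewrite -sqrf_eq0; apply/eqP/z => // j _; exact: sqr_ge0.
Qed.

Lemma enorm_le n (x : 'rV[R]_n) (M : R) : `|x| <= M ->
  enorm x <= Num.sqrt (n%:R * M ^+ 2).
Proof.
move=> xM; apply: ler_wsqrtr.
rewrite -[X in X%:R * _]card_ord -sum1_card natr_sum mulr_suml.
apply: ler_sum => i _; rewrite mul1r -real_normK ?num_real//.
rewrite lerXn2r ?nnegrE//; first exact: le_trans xM.
exact: le_trans (normr_coord_le x i) xM.
Qed.

Lemma enormZ n (a : R) (x : 'rV[R]_n) : 0 <= a -> enorm (a *: x) = a * enorm x.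
Proof.
move=> a0; rewrite /enorm.
under eq_bigr do rewrite mxE exprMn.
by rewrite -mulr_sumr sqrtrM ?sqr_ge0// sqrtr_sqr ger0_norm.
Qed.

(** The supremum is not attained because Omega is open: a point can be moved
    outwards along itself. This makes ln (R / |x'|) positive on Omega. *)
Lemma enorm_stratum1_lt_sup N m (Omega : set 'rV[R]_(N + m)) x :
  open Omega -> bounded_set Omega -> Omega x -> stratum1 x != 0 ->
  enorm (stratum1 x) < sup [set enorm (stratum1 x) | x in Omega].
Proof.
move=> oO bO Ox x0.
have ub : has_ubound [set enorm (stratum1 x) | x in Omega].
  have [B [_ HB]] := bO.
  exists (Num.sqrt (N%:R * (B + 1) ^+ 2)) => _ [y Oy <-].
  apply: enorm_le; apply: le_trans (HB (B + 1) _ y Oy); last by rewrite ltrDl.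
  rewrite [leLHS]/Num.Def.normr /= mx_normrE; apply: bigmax_le => // -[i j] _.
  by rewrite /= (ord1 i) mxE; exact: normr_coord_le.
have c : {for 0, continuous (fun t : R => t *: x + x)}.
  apply: cvgD; last exact: cvg_cst.
  exact: cvgZr_tmp.
have : nbhs (0 : R) [set t | Omega (t *: x + x)].
  apply: c => /=; rewrite scale0r add0r.
  exact: open_nbhs_nbhs.
move=> /nbhs_ballP[e /= e0 eO].
have Oe : Omega ((e / 2) *: x + x).
  apply: eO; rewrite -ball_normE /= sub0r normrN gtr0_norm ?divr_gt0//.
  by rewrite ltr_pdivrMr// ltr_pMr// ltr1n.
apply: lt_le_trans (ub_le_sup ub _); last by exists ((e / 2) *: x + x).
rewrite (_ : stratum1 (_ + _) = (e / 2 + 1) *: stratum1 x).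
  rewrite enormZ ?addr_ge0// ?divr_ge0 ?(ltW e0)//.
  by rewrite ltr_pMl ?enorm_gt0// ltrDr divr_gt0.
by apply/rowP => i; rewrite !mxE mulrDl mul1r.
Qed.

End norms.

Theorem theorem4p1 (R : realType) (N : nat) (Ns : seq nat)
    (G : stratified_group R N Ns) (Omega : set 'rV[R]_(N + sumn Ns))
    (f : 'rV[R]_(N + sumn Ns) -> R[i]) :
  (1 < N)%N ->
  open Omega -> connected Omega -> bounded_set Omega -> Omega 0 ->
  Cc_infty (Omega `\` [set x | stratum1 x = 0]) f ->
  let rad : R := sup [set enorm (stratum1 x) | x in Omega] in
  (Lp_norm Omega N%:R
     (fun x => f x / (enorm (stratum1 x) * ln (rad / enorm (stratum1 x)))%:C%C)%R
   <= (N%:R / (N%:R - 1))%:E *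
      Lp_norm Omega N%:R
        (fun x => dotc ((enorm (stratum1 x))^-1 *: stratum1 x)
                       (hgradient G f x))%R)%E.
Proof.
move=> N1 oO _ bO _ [fre fim cK KO]; cbv zeta; set rad := sup _.
set K := closure _ in cK KO.
pose u x := complex.Re (f x); pose v x := complex.Im (f x).
have uC1 : is_Ck 1 u by exact: fre.
have vC1 : is_Ck 1 v by exact: fim.
have clK : closed K by exact: closed_closure.
have f_off x : ~ K x -> f x = 0.
  move=> Kx; apply: contrapT => /eqP fx; apply: Kx; exact: subset_closure.
have Krad x : K x -> 0 < enorm (stratum1 x) < rad.
  move=> /KO[Ox /= /eqP x0].
  by rewrite enorm_gt0//= enorm_stratum1_lt_sup.
have Koff x : ~ K x -> u x = 0 /\ v x = 0 by move=> /f_off; rewrite /u /v => ->.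
have [M Kbnd] : exists M, forall (x : 'rV[R]_(N + sumn Ns)) i,
    M < `|x ord0 i| -> ~ K x.
  have [B [_ HB]] := compact_bounded cK.
  exists (B + 1) => x i Mx Kx; move: Mx; apply/negP; rewrite -leNgt.
  apply: le_trans (normr_coord_le x i) _; apply: HB => //.
  by rewrite ltrDl.
have N0 : N%:R != 0 :> R by rewrite pnatr_eq0 gtn_eqF// ltnW.
have main := hardy_integral_power G N1 uC1 vC1 clK Krad Koff Kbnd.
(* Off K both sides vanish, so the restriction to Omega is invisible and the
   norms become integrals over the whole space. *)
have lhsE x : (`|((fun x =>
      (ComplexField.Normc.normc (f x / (enorm (stratum1 x) *
        ln (rad / enorm (stratum1 x)))%:C%C))%:E) \_ Omega) x| `^ N%:R)%E =
    ((modulus (u x) (v x) / (enorm (stratum1 x) *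
         ln (rad / enorm (stratum1 x)))) ^+ N)%:E.
  have [Kx|Kx] := pselect (K x).
    have [Ox _] := KO _ Kx; have [s0 srad] := andP (Krad x Kx).
    have d0 : 0 <= enorm (stratum1 x) * ln (rad / enorm (stratum1 x)).
      by rewrite mulr_ge0 ?enorm_ge0// ltW// ln_quotient_gt0// Krad.
    rewrite patchE mem_set// ComplexField.Normc.normcM.
    rewrite ComplexField.Normc.normcV normcR//.
    rewrite normc_modulus abse_EFin poweR_EFin powR_mulrn//.
    by rewrite ger0_norm// divr_ge0// modulus_ge0.
  have -> : ((fun x => (ComplexField.Normc.normc (f x / (enorm (stratum1 x) *
    ln (rad / enorm (stratum1 x)))%:C%C))%:E) \_ Omega) x = 0%E.
    by rewrite patchE f_off// mul0r ComplexField.Normc.normc0; case: ifP.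
  have [-> ->] := Koff x Kx.
  rewrite abse0 poweR_EFin powR0// /modulus expr0n addr0 sqrtr0 mul0r expr0n.
  by rewrite gtn_eqF// ltnW.
have gradE x : ComplexField.Normc.normc
      (dotc ((enorm (stratum1 x))^-1 *: stratum1 x) (hgradient G f x)) =
    modulus ('D_(radial_field G x) u x) ('D_(radial_field G x) v x) /
      enorm (stratum1 x).
  rewrite normc_modulus -modulusMr ?invr_ge0 ?enorm_ge0//.
  have DY (g : 'rV[R]_(N + sumn Ns) -> R) : is_Ck 1 g ->
      'D_(radial_field G x) g x =
      \sum_k stratum1 x ord0 k * 'D_(sg_field G k x) g x.
    move=> [dg _]; rewrite deriveE// linear_sum; apply: eq_bigr => k _.
    by rewrite linearZ deriveE.
  rewrite (DY u)// (DY v)// /dotc !mulr_suml; congr modulus.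
    rewrite (raddf_sum (@complex.Re R)); apply: eq_bigr => k _.
    by rewrite !mxE /= mul0r subr0; ring.
  rewrite (raddf_sum (@complex.Im R)); apply: eq_bigr => k _.
  by rewrite !mxE /= mul0r addr0; ring.
have rhsE x : (`|((fun x => (ComplexField.Normc.normc
      (dotc ((enorm (stratum1 x))^-1 *: stratum1 x) (hgradient G f x)))%:E)
      \_ Omega) x| `^ N%:R)%E =
    ((modulus ('D_(radial_field G x) u x) ('D_(radial_field G x) v x) /
         enorm (stratum1 x)) ^+ N)%:E.
  rewrite patchE; case: ifPn => Ox.
    rewrite gradE abse_EFin poweR_EFin powR_mulrn// ger0_norm//.
    by rewrite divr_ge0 ?modulus_ge0 ?enorm_ge0.
  have Kx : ~ K x by move=> /KO[/mem_set]; rewrite (negPf Ox).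
  have nK : \near x, ~ K (x : 'rV[R]_(N + sumn Ns)).
    by apply: open_nbhs_nbhs; split => //; exact: closed_openC.
  rewrite !derive_near0; last 2 first.
  - by apply: filterS nK => y /Koff[].
  - by apply: filterS nK => y /Koff[].
  rewrite abse0 poweR_EFin powR0// /modulus expr0n addr0 sqrtr0 mul0r expr0n.
  by rewrite gtn_eqF// ltnW.
rewrite /Lp_norm !unlock /=.
rewrite (eq_integral _ _ (fun x _ => lhsE x)).
rewrite (eq_integral _ _ (fun x _ => rhsE x)).
have N1R : 0 <= N%:R / (N%:R - 1) :> R.
  by rewrite divr_ge0// subr_ge0 ler1n ltnW.
have int0 (g : 'rV[R]_(N + sumn Ns) -> R) : (forall x, 0 <= g x) ->
    (0 <= \int[lebesgue_rV (N + sumn Ns)]_x (g x)%:E)%E.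
  by move=> g0; apply: integral_ge0 => x _; rewrite lee_fin.
have lhs0 x : 0 <= (modulus (u x) (v x) / (enorm (stratum1 x) *
         ln (rad / enorm (stratum1 x)))) ^+ N.
  by rewrite -lee_fin -lhsE poweR_ge0.
have rhs0 x : 0 <=
    (modulus ('D_(radial_field G x) u x) ('D_(radial_field G x) v x) /
         enorm (stratum1 x)) ^+ N.
  by rewrite exprn_ge0// divr_ge0 ?modulus_ge0 ?enorm_ge0.
have Ninv0 : 0 <= N%:R^-1 :> R by rewrite invr_ge0.
apply: le_trans (gt0_ler_poweR Ninv0 _ _ main) _.
- by rewrite in_itv/= int0// leey.
- by rewrite in_itv/= leey mule_ge0// ?lee_fin ?exprn_ge0// int0.
rewrite poweRM ?int0// ?lee_fin ?exprn_ge0//.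
by rewrite poweR_EFin -powR_mulrn// -powRrM mulfV// powRr1.
Qed.
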